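(* For every $n \geq 0$ and every rooted planar map $M$ with $n$ edges, $\rho(M) = \rho'(M)$.
   Context: A rooted planar map has a marked root corner on the outer face, whose vertex is the root vertex; the root edge is the edge next to the root corner in clockwise order; the empty map is a single vertex. $\operatorname{outv}(M)$ is the number of vertices incident to the outer face. A one-corner component is a rooted planar map whose root corner is the only corner of the root vertex on the outer face; $\operatorname{outv}_{\mathcal{U}}(U)$ is the number of outer-face vertices of $U$ other than the root vertex. For a non-empty one-corner component $U$ with root edge $e$, $\Pi(U)$ is obtained by deleting $e$ and re-rooting at the corner from which the other end of $e$ stems. Recursive map $\rho$ (to labeled plane trees): $\rho$(empty map) is a single node labeled $1$. If $M$ has at least one edge, with root vertex $v_M$, cut $M$ at each corner of $v_M$ incident to the outer face (duplicating $v_M$), obtaining one-corner components $U_1,\ldots,U_k$ (each rooted at its copy of $v_M$), listed counter-clockwise starting from the root corner; let $M_i = \Pi(U_i)$. Then $\rho(M)$ has a root labeled $\operatorname{outv}(M)$ whose children, from left to right, are the roots of copies of $\rho(M_1),\ldots,\rho(M_k)$, where all labels are kept except that the root of the copy of $\rho(M_i)$ is relabeled $\operatorname{outv}_{\mathcal{U}}(U_i)$. Direct map $\rho'$: label the root vertex of $M$ by $\operatorname{outv}(M)$, and perform a clockwise contour walk from the root corner. Traversing an already visited edge does nothing. When at a corner $c$ about to traverse a new edge $e$ from $v$ to $w$: let $c_1$ be the corner of $v$ on the other side of $e$, and $c_2$ the next corner of $v$ in clockwise direction that is incident to the outer face; the part of the map between $c$ and $c_2$ is a one-corner component $U$, and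 $w$ receives label $\operatorname{outv}_{\mathcal{U}}(U)$. If $c_1 = c_2$ ($e$ is a bridge), do nothing more; if $c_1 \neq c_2$, detach the part of the map between $c_1$ and $c_2$ at $v$, duplicating $v$. At the end of the walk the map is a vertex-labeled plane tree rooted at the original root corner, denoted $\rho'(M)$. *)

(* Defs.v *)
From mathcomp Require Import all_boot.
Set Implicit Arguments. Unset Strict Implicit. Unset Printing Implicit Defensive.

Inductive ltree := Node of nat & seq ltree.

Definition relabel (t : ltree) (l : nat) : ltree :=
  let: Node _ cs := t in Node l cs.

(* Combinatorial maps.  Darts are natural numbers listed in [md].
   [msg x] = next dart CLOCKWISE around the vertex of x;
   [mal x] = the other half of the edge of x.
   A corner is encoded by the dart immediately clockwise after it:
   corner x = the angular sector between (msg^-1 x) and x, at the vertex of x.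
   [mroot] encodes the root corner; hence the root edge (the edge next to the
   root corner in clockwise order) is the edge of dart [mroot], and the root
   vertex is the vertex of [mroot].  The empty map (single vertex, no edge)
   is the map with no dart. *)
Record cmap := CMap { md : seq nat; msg : nat -> nat; mal : nat -> nat; mroot : nat }.

(* face permutation on corners: the corner following corner x along its face
   (clockwise contour walk of the outer face): traverse the edge of x, then
   take the next edge clockwise at the other end. *)
Definition mphi (M : cmap) (x : nat) : nat := msg M (mal M x).

(* orbit of x under f, assuming its length is at most N *)
Definition porb (N : nat) (f : nat -> nat) (x : nat) : seq nat :=
  let s := traject f x N.+1 in take (index x (behead s)).+1 s.

Definition orep (N : nat) (f : nat -> nat) (x : nat) : nat :=
  foldr minn x (porb N f x).

Fixpoint clos (k : nat) (step : nat -> seq nat) (s : seq nat) : seq nat :=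
  match k with
  | 0 => s
  | k'.+1 => clos k' step (undup (s ++ flatten (map step s)))
  end.

Definition perm_on (D : seq nat) (f : nat -> nat) : Prop :=
  {in D, forall x, f x \in D} /\ {in D &, injective f}.

Definition nverts (M : cmap) : nat :=
  size (undup [seq orep (size (md M)) (msg M) x | x <- md M]).
Definition nfaces (M : cmap) : nat :=
  size (undup [seq orep (size (md M)) (mphi M) x | x <- md M]).

(* A rooted planar map: a connected rotation system of genus 0
   (Euler: V - E + F = 2), with a root corner. *)
Definition rooted_planar_map (M : cmap) : Prop :=
  [/\ uniq (md M), perm_on (md M) (msg M) & perm_on (md M) (mal M)] /\
  {in md M, forall x, mal M (mal M x) = x /\ mal M x != x} /\
  (md M != [::] -> mroot M \in md M) /\
  {in md M, forall x, x \in clos (size (md M))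
                           (fun y => [:: msg M y; mal M y]) [:: mroot M]} /\
  (md M != [::] -> nverts M + nfaces M = (size (md M)) %/ 2 + 2).

Definition outer_face (M : cmap) : seq nat := porb (size (md M)) (mphi M) (mroot M).

Definition outv (M : cmap) : nat :=
  if md M == [::] then 1
  else size (undup [seq orep (size (md M)) (msg M) x | x <- outer_face M]).

Definition outvU (U : cmap) : nat :=
  let N := size (md U) in
  size (undup [seq orep N (msg U) x | x <- outer_face U
                 & orep N (msg U) x != orep N (msg U) (mroot U)]).

(* split a sequence into maximal runs, each starting with an element of p
   (assuming the first element satisfies p) *)
Definition runs_step (p : pred nat) (x : nat) (acc : seq (seq nat)) :=
  match acc with
  | cur :: rest => if p x then [::] :: (x :: cur) :: rest else (x :: cur) :: rest
  | [::] => [:: [:: x]]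
  end.
Definition runs (p : pred nat) (s : seq nat) : seq (seq nat) :=
  behead (foldr (runs_step p) [:: [::]] s).

(* cutting the vertex of Iv: the darts of the nonempty interval Iv
   (a clockwise run of darts at a vertex) become a vertex on their own *)
Definition cut_sg (s : nat -> nat) (Iv : seq nat) (x : nat) : nat :=
  if x \in Iv then (if x == last (head 0 Iv) Iv then head 0 Iv else s x) else s x.

(* the one-corner component obtained from the interval Iv (clockwise run of
   darts of a vertex v, starting just after a corner c of v on the outer face
   and ending just before the next outer corner of v), rooted at its copy of c *)
Definition comp (M : cmap) (Iv : seq nat) : cmap :=
  let s := cut_sg (msg M) Iv in
  CMap (clos (size (md M)) (fun x => [:: mal M x; s x]) Iv) s (mal M) (head 0 Iv).

(* the one-corner components U_1, ..., U_k of a nonempty map, obtained by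
   cutting at the outer corners of the root vertex, listed counter-clockwise
   starting from the root corner *)
Definition comps (M : cmap) : seq cmap :=
  if md M == [::] then [::] else
  let N := size (md M) in
  let vo := porb N (msg M) (mroot M) in
  let outer := outer_face M in
  [seq comp M Iv | Iv <- rev (runs (fun x => x \in outer) vo)].

(* successor skipping removed darts (at most two consecutive ones) *)
Definition skip (rem : seq nat) (s : nat -> nat) (x : nat) : nat :=
  let y := s x in
  if y \in rem then (let z := s y in if z \in rem then s z else z) else y.

(* Pi(U): delete the root edge e and re-root at the corner from which the
   other end of e stems *)
Definition Pi (U : cmap) : cmap :=
  let d := mroot U in
  let rem := [:: d; mal U d] in
  CMap [seq x <- md U | x \notin rem] (skip rem (msg U)) (mal U)
       (skip rem (msg U) (mal U d)).

Fixpoint rho_f (k : nat) (M : cmap) : ltree :=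
  match k with
  | 0 => Node (outv M) [::]
  | k'.+1 => Node (outv M) [seq relabel (rho_f k' (Pi U)) (outvU U) | U <- comps M]
  end.

Definition rho (M : cmap) : ltree := rho_f (size (md M)).+1 M.

Record wstate := WState { ws_sg : nat -> nat; ws_vis : seq nat;
                          ws_lab : nat -> nat; ws_cur : nat }.

Definition wstep (M : cmap) (st : wstate) : wstate :=
  let N := size (md M) in
  let a := mal M in
  let r := mroot M in
  let s := ws_sg st in
  let d := ws_cur st in
  if d \in ws_vis st then WState s (ws_vis st) (ws_lab st) (s (a d)) else
  let cur := CMap (md M) s a r in
  let outer := outer_face cur in
  let tl := behead (porb N s d) in
  let i := find (fun x => x \in outer) tl in
  (* c_2 = next clockwise outer corner of v (c itself if there is none) *)
  let c2 := nth d tl i in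
  let Iv := d :: take i tl in
  let l := outvU (comp cur Iv) in
  (* part between c_1 and c_2; empty iff c_1 = c_2 *)
  let J := behead Iv in
  let s' := if J is [::] then s
            else fun x => if x == d then c2
                          else if x == last d J then head d J else s x in
  let lab' := fun x => if x \in porb N s' (a d) then l else ws_lab st x in
  WState s' [:: d, a d & ws_vis st] lab' (s' (a d)).

Fixpoint walk (M : cmap) (k : nat) (st : wstate) : wstate :=
  match k with
  | 0 => st
  | k'.+1 => let st' := wstep M st in
             if ws_cur st' == mroot M then st' else walk M k' st'
  end.

(* reading the final labeled map (a tree) as a plane tree: children in
   counter-clockwise order starting from the parent edge / root corner *)
Fixpoint tree_of (N : nat) (s a lab : nat -> nat) (k : nat) (x : nat) : ltree :=
  match k with
  | 0 => Node (lab x) [::]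
  | k'.+1 => Node (lab x) [seq tree_of N s a lab k' (a y) | y <- rev (behead (porb N s x))]
  end.

Definition rho' (M : cmap) : ltree :=
  if md M == [::] then Node (outv M) [::] else
  let N := size (md M) in
  let r := mroot M in
  let init := WState (msg M) [::]
                (fun x => if x \in porb N (msg M) r then outv M else 0) r in
  let st := walk M (4 * N + 4) init in
  let s := ws_sg st in
  Node (ws_lab st r)
       [seq tree_of N s (mal M) (ws_lab st) N (mal M y) | y <- rev (porb N s r)].

(* Main.v *)
From mathcomp Require Import all_boot all_fingroup zify.
Require Import Defs.
Set Implicit Arguments. Unset Strict Implicit. Unset Printing Implicit Defensive.

(** Both constructions perform the same splittings of the vertex rotation, [rho]
recursively and [rho'] along one contour walk. Planarity is needed only to
know that a part of the map lying between two consecutive outer corners of a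
vertex is attached to the rest by that vertex alone. This is a Jordan-type
property: write #V + #F - #E for a rotation system as a count of permutation
cycles; it is at most twice the number of connected components. Cutting a vertex
between two corners of the same face adds one vertex and one face, so in genus 0
it must disconnect the map, whereas a cut between corners of two different
faces merges these faces and keeps the map connected. In both cases genus 0
survives, so the property passes to the one-corner components [U] and to the
maps [Pi U].

When the walk reaches the root corner of a one-corner component [U], the current
corner is outer, and the outer corners of the current map inside [U] are the
outer corners of [U]; hence the walk splits off exactly the part that
[Pi] re-attaches to the other end of the root edge. It then enters [Pi U], traverses it
completely without touching anything else, returns along the root edge, and
leaves at the next outer corner. Induction on the number of darts concludes. *)

(** * Genus of a pair of permutations *)

Section Genus.
Variable T : finType.
Implicit Types (s t : {perm T}) (x y z : T).

Definition glink s t : rel T := relU (frel s) (frel t).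
Definition gclass s t x : {set T} := [set y | connect (glink s t) x y].
Definition ncc s t : nat := #|[set gclass s t x | x : T]|.
(** If [t] is a fixed-point-free involution, [#|T| - #|porbits t|] is the number of edges, so this
    reads V - E + F >= 2c with c components. [genus_ge0] gives the opposite inequality. *)
Definition genus0 s t : Prop :=
  #|T| + (ncc s t).*2 <= #|porbits s| + #|porbits t| + #|porbits (s * t)%g|.

Lemma glink_sym s t : connect_sym (glink s t).
Proof. by apply: relU_sym; apply: fconnect_sym; apply: perm_inj. Qed.

Lemma gclass_refl s t x : x \in gclass s t x.
Proof. by rewrite inE connect0. Qed.

Lemma gclass_eq s t x y : y \in gclass s t x -> gclass s t y = gclass s t x.
Proof.
rewrite inE => xy; apply/setP => z; rewrite !inE.
by rewrite -(same_connect (glink_sym s t) xy).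
Qed.

Lemma gclassL s t x y : (s y \in gclass s t x) = (y \in gclass s t x).
Proof.
have e : connect (glink s t) y (s y) by rewrite connect1 // /glink /= eqxx.
by rewrite !inE (same_connect_r (glink_sym s t) e).
Qed.

Lemma gclassR s t x y : (t y \in gclass s t x) = (y \in gclass s t x).
Proof.
have e : connect (glink s t) y (t y) by rewrite connect1 // /glink /= eqxx orbT.
by rewrite !inE (same_connect_r (glink_sym s t) e).
Qed.

Lemma gclass_min s t (A : {set T}) x :
  {in A, forall y, s y \in A} -> {in A, forall y, t y \in A} -> x \in A ->
  gclass s t x \subset A.
Proof.
move=> sA tA xA; apply/subsetP => y; rewrite inE => xy.
have cl : closed (glink s t) (mem A).
  apply: (intro_closed (glink_sym s t)) => u v /orP[] /= /eqP <-; [exact: sA|exact: tA].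
by have /= <- := closed_connect cl xy.
Qed.

Lemma porbit_gclass s t x : porbit s x \subset gclass s t x.
Proof.
apply/subsetP => y /porbitP[i ->]; rewrite permX.
elim: i => [|i IH] /=; [exact: gclass_refl|by rewrite gclassL].
Qed.

Lemma porbit_gclassM s t x : porbit (s * t)%g x \subset gclass s t x.
Proof.
apply/subsetP => y /porbitP[i ->]; rewrite permX.
elim: i => [|i IH] /=; [exact: gclass_refl|by rewrite permM gclassR gclassL].
Qed.

(** The transposition reroutes only the arrows leaving [x] and [y]. Classes containing neither are
    untouched; the single old class of both points gives way to at most the two new classes
    collected in [B]. *)
Lemma ncc_split s t x y : y \in gclass s t x ->
  ncc (tperm x y * s)%g t <=
    ncc s t + (y \notin gclass (tperm x y * s)%g t x).
Proof.
move=> xy; set s' := (tperm x y * s)%g.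
have ss' z : s z = s' (tperm x y z) by rewrite permM tpermK.
have out z : x \notin gclass s' t z -> y \notin gclass s' t z ->
    gclass s' t z = gclass s t z /\ x \notin gclass s t z.
  move=> nx ny.
  have sub : gclass s t z \subset gclass s' t z.
    apply: gclass_min => [u uz|u|]; [|by rewrite gclassR|exact: gclass_refl].
    rewrite ss' gclassL tpermD //; first by apply: contraNneq nx => ->.
    by apply: contraNneq ny => ->.
  have nx' : x \notin gclass s t z by apply: contraNN nx; apply: (subsetP sub).
  split=> //; apply/eqP; rewrite eqEsubset sub andbT.
  apply: gclass_min => [u uz|u|]; [|by rewrite gclassR|exact: gclass_refl].
  rewrite permM gclassL tpermD //; first by apply: contraNneq nx' => ->.
  apply: contraNneq nx' => yu; rewrite -(gclass_eq uz) -yu (gclass_eq xy).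
  exact: gclass_refl.
set B := [set gclass s' t z | z in [set x; y]].
have cB : #|B| <= 1 + (y \notin gclass s' t x).
  case: (boolP (y \in _)) => yx /=.
    rewrite addn0 (leq_trans (subset_leq_card (_ : B \subset [set gclass s' t x]))) ?cards1 //.
    apply/subsetP => _ /imsetP[z /set2P[] -> ->]; rewrite inE //.
    by rewrite (gclass_eq yx).
  by rewrite (leq_trans (leq_imset_card _ _)) // cards2; case: (_ != _).
have sub : [set gclass s' t z | z : T] \subset
    ([set gclass s t z | z : T] :\ gclass s t x) :|: B.
  apply/subsetP => _ /imsetP[z _ ->]; rewrite !inE.
  case: (boolP (x \in gclass s' t z)) => xz.
    by rewrite -(gclass_eq xz) imset_f ?orbT // !inE eqxx.
  case: (boolP (y \in gclass s' t z)) => yz.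
    by rewrite -(gclass_eq yz) imset_f ?orbT // !inE eqxx orbT.
  have [-> nx] := out z xz yz; rewrite imset_f // andbT.
  by rewrite (contraNneq _ nx) // => ->; exact: gclass_refl.
have := subset_leq_card sub; rewrite -/(ncc s' t) => /leq_trans; apply.
rewrite (leq_trans (leq_card_setU _ _)) // (leq_trans (leq_add (leqnn _) cB)) //.
rewrite addnA leq_add2r addnC /ncc.
by rewrite [X in _ <= X](cardsD1 (gclass s t x)) imset_f.
Qed.

(** Each of [s] and [s'] arises from the other by the same transposition. The two resulting counts
    are compatible only if exactly one of them has [x] and [y] in one cycle. *)
Lemma porbits_tperm s x y (s' := (tperm x y * s)%g) : x != y ->
  (y \in porbit s' x) = (y \notin porbit s x) /\
  #|porbits s'| + (y \notin porbit s x) = #|porbits s| + (y \in porbit s x).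
Proof.
move=> xy; have := porbits_mul_tperm s x y; have := porbits_mul_tperm s' x y.
rewrite /= {1}/s' mulgA tperm2 mul1g xy !(porbit_sym _ x y) -/s'.
move: #|porbits s| #|porbits s'| => a b.
by case: (y \in porbit s x); case: (y \in porbit s' x) => /= *; split=> //; lia.
Qed.

(** Splitting off [s x] as a fixed point adds a cycle to [s]. If a face splits too, at most one
    component appears; if two faces merge, [x] and [s x] share a new face, stay connected, and no
    component appears. For [s = 1] components and faces are both the cycles of [t]. *)
Lemma genus_ge0 s t :
  #|porbits s| + #|porbits t| + #|porbits (s * t)%g| <= #|T| + (ncc s t).*2.
Proof.
have [m le_m] := ubnP (#|T| - #|porbits s|).
elim: m s le_m => // m IH s le_m.
have leT (u : {perm T}) : #|porbits u| <= #|T|.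
  exact: leq_imset_card.
have [x sx | fix_s] := pickP (fun x => s x != x); last first.
  have -> : s = 1%g by apply/permP => x; rewrite perm1; apply/eqP/negPn; rewrite fix_s.
  rewrite mul1g -addnA addnn leq_add ?leT // leq_double.
  have E z : gclass 1 t z = porbit t z.
    apply/eqP; rewrite eqEsubset; apply/andP; split.
      apply: gclass_min => [u|u|]; rewrite ?perm1 ?porbit_id //.
      move=> /porbitP[i ->]; apply/porbitP; exists i.+1.
      by rewrite !permX.
    by have := porbit_gclassM 1 t z; rewrite mul1g.
  by rewrite /ncc (eq_imset _ E).
have yx : s x \in porbit s x by rewrite -{1}(expg1 s) mem_porbit.
have xy : x != s x by rewrite eq_sym.
set s' := (tperm x (s x) * s)%g.
have [_] := porbits_tperm s xy; rewrite yx /= addn0 addn1 -/s' => cs'.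
have := IH s'; have := leT s'; rewrite cs' => lt {}IH.
have {IH lt} := IH (leq_trans (ltn_sub2l lt (ltnSn _)) le_m).
have xyc : s x \in gclass s t x by rewrite gclassL gclass_refl.
have := ncc_split xyc; rewrite -/s'.
have [] := porbits_tperm (s * t)%g xy; rewrite mulgA -/s'.
have : s x \in porbit (s' * t)%g x -> s x \in gclass s' t x.
  exact/subsetP/porbit_gclassM.
move: #|porbits s| #|porbits t| #|porbits (s * t)%g| #|porbits (s' * t)%g| #|T|.
move: (ncc s t) (ncc s' t) (s x \in gclass s' t x) => c c' b n1 n2 n3 n4 n5.
move=> hb eb; move: hb; rewrite eb.
case: (s x \in porbit (s * t)%g x) => /=; last by move=> ->; lia.
by case: b; lia.
Qed.

(* Splitting a cycle of [s] never destroys genus 0; when both ends lie in one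
   face, the face count grows too and Euler's inequality forces a
   disconnection. *)
Lemma genus0_split s t x y : genus0 s t -> x != y -> y \in porbit s x ->
  let s' := (tperm x y * s)%g in
  genus0 s' t /\ (y \in gclass s' t x) = (y \notin porbit (s * t)%g x).
Proof.
move=> g xy yx s'.
have yc : y \in gclass s t x by apply: (subsetP (porbit_gclass s t x)).
have [_] := porbits_tperm s xy; rewrite yx /= addn0 addn1 -/s' => cs'.
have := ncc_split yc; have [] := porbits_tperm (s * t)%g xy; rewrite mulgA -/s'.
have : y \in porbit (s' * t)%g x -> y \in gclass s' t x.
  exact/subsetP/porbit_gclassM.
have := genus_ge0 s' t; move: g; rewrite /genus0 cs'.
move: #|porbits s| #|porbits t| #|porbits (s * t)%g| #|porbits (s' * t)%g| #|T|.
move: (ncc s t) (ncc s' t) (y \in gclass s' t x) => c c' b n1 n2 n3 n4 n5.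
move=> g1 g2 hb eb; move: hb; rewrite eb.
case: (y \in porbit (s * t)%g x) => /=; last first.
  by move=> -> //=; split=> //; lia.
by case: b => /=; [lia|split=> //; lia].
Qed.
End Genus.

(** * Orbits, closures and rotation systems on sequences of naturals *)

Lemma porb_cycle N f x p :
  fcycle f (x :: p) -> uniq (x :: p) -> size p < N -> porb N f x = x :: p.
Proof.
move=> /= cyc /andP[xp _] ltN; have /fpathE := cyc; rewrite size_rcons => tr.
rewrite /porb /= -(subnKC ltN) trajectD -tr index_cat mem_rcons mem_head.
rewrite -cats1 index_cat (negPf xp) /= eqxx addn0 -catA.
by rewrite take_size_cat.
Qed.

Lemma perm_on_cycle D f x : uniq D -> perm_on D f -> x \in D ->
  exists p, [/\ fcycle f (x :: p), uniq (x :: p) & {subset x :: p <= D}].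
Proof.
move=> uD [fD fI] xD.
have itD n : iter n f x \in D by elim: n => //= n; apply: fD.
have trD n : {subset traject f x n <= D} by move=> _ /trajectP[i _ ->].
have ex : exists n, ~~ uniq (traject f x n.+1).
  exists (size D); apply/negP => u.
  by have := uniq_leq_size u (trD _); rewrite size_traject ltnn.
have [n nu min] := ex_minnP ex.
have n0 : 0 < n by case: n nu {min}.
have u : uniq (traject f x n).
  by rewrite -(prednK n0); apply/negPn/negP => /min; rewrite leqNgt prednK // leqnn.
have /trajectP[[|i] ltin e] : iter n f x \in traject f x n.
  by move: nu; rewrite looping_uniq negbK.
  exists (traject f (f x) n.-1).
  have <- : traject f x n = x :: traject f (f x) n.-1 by rewrite -[in LHS](prednK n0).
  split=> //; rewrite -[in traject f x n](prednK n0) /= -[X in rcons _ X]e.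
  have -> : iter n f x = iter n.-1 f (f x) by rewrite -iterSr prednK.
  by rewrite -trajectSr fpath_traject.
(* A first repetition at a positive index can be pulled back one step by injectivity, against the
   minimality of [n]. *)
have e' : iter n.-1 f x = iter i f x.
  by apply: fI => //; rewrite -!iterS prednK.
case/negP: (nu); move: u; rewrite -(prednK n0) looping_uniq => /negP[].
by apply/trajectP; exists i => //; lia.
Qed.

Lemma porbP N D f x : uniq D -> perm_on D f -> x \in D -> size D <= N ->
  exists p, [/\ porb N f x = x :: p, fcycle f (x :: p), uniq (x :: p)
              & {subset x :: p <= D}].
Proof.
move=> uD pf xD leN; have [p [cp up sp]] := perm_on_cycle uD pf xD.
exists p; split=> //; apply: porb_cycle => //.
by apply: leq_trans leN; apply: (uniq_leq_size up).
Qed.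

Lemma perm_on_surj D f y : uniq D -> perm_on D f -> y \in D ->
  exists2 x, x \in D & f x = y.
Proof.
move=> uD pf yD; have [p [/= cyc _ sp]] := perm_on_cycle uD pf yD.
exists (last y p); first by apply/sp/mem_last.
by move: cyc; rewrite rcons_path => /andP[_ /eqP].
Qed.

Lemma perm_on_eq D f g : {in D, f =1 g} -> perm_on D f -> perm_on D g.
Proof.
move=> e [fD fI]; split=> [x xD|x y xD yD]; rewrite -?e //; first exact: fD.
exact: fI.
Qed.

Lemma perm_on_swap D f x y : perm_on D f -> x \in D -> y \in D ->
  perm_on D (fun z => if z == x then f y else if z == y then f x else f z).
Proof.
move=> [fD fI] xD yD; split=> [z zD|z t zD tD].
  by case: eqP => _; [|case: eqP => _]; apply: fD.
case: (z =P x) => [->|zx]; [|case: (z =P y) => [->|zy]];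
 (case: (t =P x) => [->|tx]; [|case: (t =P y) => [->|ty]]) => // /fI H;
 move: (H ltac:(done) ltac:(done)); intuition congruence.
Qed.

Lemma fcycle_eq_in (D : seq nat) f g c : {subset c <= D} -> {in D, f =1 g} ->
  fcycle f c -> fcycle g c.
Proof.
move=> sc e; rewrite (@eq_in_cycle _ (mem D) (frel f) (frel g)) //; last exact/allP.
by move=> x y xD _ /=; rewrite e.
Qed.

Lemma eq_porb N N' D f g x : uniq D -> perm_on D f -> {in D, f =1 g} -> x \in D ->
  size D <= N -> size D <= N' -> porb N f x = porb N' g x.
Proof.
move=> uD pf e xD leN leN'; have [p [-> cp up sp]] := porbP uD pf xD leN.
symmetry; apply: porb_cycle => //; first exact: fcycle_eq_in sp e cp.
by apply: leq_trans leN'; apply: (uniq_leq_size up).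
Qed.

Lemma fcycle_iter (f : nat -> nat) c x n : fcycle f c -> x \in c -> iter n f x \in c.
Proof. by move=> cc xc; elim: n => //= n; apply: (mem_fcycle cc). Qed.

Lemma fcycle_reach (f : nat -> nat) x p y : fcycle f (x :: p) -> y \in x :: p ->
  exists n, iter n f x = y.
Proof.
move=> /= cyc; rewrite inE => /predU1P[->|yp]; first by exists 0.
have /fpathE := cyc; rewrite size_rcons => e.
have : y \in rcons p x by rewrite mem_rcons inE yp orbT.
by rewrite e => /trajectP[i _ ->]; exists i.+1; rewrite iterSr.
Qed.

Lemma mem_porb N D f x y : uniq D -> perm_on D f -> x \in D -> size D <= N ->
  reflect (exists n, iter n f x = y) (y \in porb N f x).
Proof.
move=> uD pf xD leN; apply: (iffP idP) => [|[n <-]]; have [p [-> cp up sp]] := porbP uD pf xD leN.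
  exact: fcycle_reach.
by apply: fcycle_iter; rewrite ?mem_head.
Qed.

Lemma perm_on_iter_sym D f x y n : uniq D -> perm_on D f -> x \in D ->
  iter n f x = y -> exists m, iter m f y = x.
Proof.
move=> uD pf xD e; have [p [cp up sp]] := perm_on_cycle uD pf xD.
have yp : y \in x :: p by rewrite -e fcycle_iter ?mem_head.
have [i q eq_rot] := rot_to yp.
apply: (@fcycle_reach _ _ q); first by rewrite -eq_rot rot_cycle.
by rewrite -eq_rot mem_rot mem_head.
Qed.

Lemma foldr_minnP x p (m := foldr minn x (x :: p)) :
  m \in x :: p /\ {in x :: p, forall y, m <= y}.
Proof.
have ge s : {in x :: s, forall y, foldr minn x s <= y}.
  elim: s => [y|z s IH y]; first by rewrite inE => /eqP->.
  rewrite !inE /= geq_min => /or3P[/eqP->|/eqP->|ys]; last first.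
  - by rewrite IH ?orbT // inE ys orbT.
  - by rewrite leqnn.
  - by rewrite IH ?orbT // inE eqxx.
have mem s : foldr minn x s \in x :: s.
  elim: s => [|z s IH] /=; first exact: mem_head.
  rewrite /minn; case: ifP => _; rewrite !inE ?eqxx ?orbT //.
  by move: IH; rewrite inE => /predU1P[->|->]; rewrite ?eqxx ?orbT.
split; last by move=> y yp; apply: (ge (x :: p)); rewrite inE yp orbT.
by have := mem (x :: p); rewrite /m !inE => /or3P[->|->|->]; rewrite ?orbT.
Qed.

Lemma eq_orep N N' D f g x : uniq D -> perm_on D f -> {in D, f =1 g} -> x \in D ->
  size D <= N -> size D <= N' -> orep N f x = orep N' g x.
Proof. by move=> uD pf e xD l l'; rewrite /orep (eq_porb uD pf e xD l l'). Qed.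

Lemma orep_mem N D f x : uniq D -> perm_on D f -> x \in D -> size D <= N ->
  (exists n, iter n f x = orep N f x) /\ forall n, orep N f x <= iter n f x.
Proof.
move=> uD pf xD leN.
have [p [ep cp up sp]] := porbP uD pf xD leN.
have [] := foldr_minnP x p; rewrite -ep -/(orep N f x) => m1 m2; split.
  exact/(mem_porb _ uD pf xD leN).
by move=> n; apply: m2; apply/(mem_porb _ uD pf xD leN); exists n.
Qed.

Lemma orepP N D f x y : uniq D -> perm_on D f -> x \in D -> y \in D ->
  size D <= N -> orep N f x = orep N f y <-> exists n, iter n f x = y.
Proof.
move=> uD pf xD yD leN.
have [[n en] mx] := orep_mem uD pf xD leN; have [[m em] my] := orep_mem uD pf yD leN.
split=> [e|[k e]].
  have [k ek] := perm_on_iter_sym uD pf yD em.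
  by exists (k + n); rewrite iterD en e ek.
have [j ej] := perm_on_iter_sym uD pf xD e.
apply/eqP; rewrite eqn_leq.
have := mx (m + k); have := my (n + j).
by rewrite !iterD e ej en em => -> ->.
Qed.

(** * Finite closure of a set of darts *)

Section Closure.
Variables (D : seq nat) (step : nat -> seq nat) (s0 : seq nat) (N : nat).
Hypotheses (us0 : uniq s0) (s0D : {subset s0 <= D}) (s0n : 0 < size s0).
Hypothesis stepD : {in D, forall x, {subset step x <= D}}.
Hypothesis leN : size D <= N.

Let closed_seq (s : seq nat) := {in s, forall x, {subset step x <= s}}.
Let next (s : seq nat) := undup (s ++ flatten (map step s)).

Let mem_next s y : reflect (y \in s \/ exists2 x, x \in s & y \in step x) (y \in next s).
Proof.
rewrite mem_undup mem_cat; apply: (iffP orP) => -[]; try by left.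
  by move=> /flatten_mapP[x xs ys]; right; exists x.
by move=> [x xs ys]; right; apply/flatten_mapP; exists x.
Qed.

Let clos_inv (A : nat -> Prop) k s : (forall x, x \in s -> A x) ->
  (forall x y, A x -> y \in step x -> A y) -> forall x, x \in clos k step s -> A x.
Proof.
move=> + H; elim: k s => //= k IH s sA; apply: IH => x /mem_next[/sA //|[y /sA]].
exact: H.
Qed.

Let clos_sub k s : {subset s <= clos k step s}.
Proof.
elim: k s => [|k IH] s x //= xs; apply: IH.
by apply/mem_next; left.
Qed.

Let clos_closed k s : closed_seq s -> closed_seq (clos k step s).
Proof.
elim: k s => //= k IH s cs; apply: IH => x xs y ys; apply/mem_next; left.
by move: xs => /mem_next[xs|[z zs xz]]; [exact: (cs x)|exact: (cs x (cs z zs x xz))].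
Qed.

Let clos_size k s : uniq s -> closed_seq (clos k step s) \/ size s + k <= size (clos k step s).
Proof.
elim: k s => [|k IH] s us; first by right; rewrite addn0.
case: (boolP (all (fun x => all (fun y => y \in s) (step x)) s)) => [/allP c|].
  by left; apply: clos_closed => x /c/allP.
move=> /allPn[x xs /allPn[y ys nys]] /=.
have un : uniq (next s) by rewrite undup_uniq.
have [|le] := IH _ un; [by left|right].
rewrite addnS -addSn (leq_trans _ le) // leq_add2r.
have u' : uniq (y :: s) by rewrite /= nys.
apply: (uniq_leq_size u') => z; rewrite inE => /predU1P[->|zs]; apply/mem_next.
  by right; exists x.
by left.
Qed.

(** A round that starts from a set not yet closed adds an element, and everything stays in [D]. As
    [s0] is non-empty, [N] such rounds would exceed [size D]. *)
Lemma closP (C := clos N step s0) :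
  [/\ uniq C, {subset s0 <= C}, {subset C <= D}, {in C, forall x, {subset step x <= C}}
    & forall A : nat -> Prop, (forall x, x \in s0 -> A x) ->
      (forall x y, x \in C -> A x -> y \in step x -> A y) -> forall x, x \in C -> A x].
Proof.
have uC : uniq C.
  rewrite /C; elim: (N) (s0) us0 => //= k IH s us; apply: IH; exact: undup_uniq.
have CD : {subset C <= D}.
  apply: (clos_inv s0D) => x y xD; exact: stepD.
have cC : closed_seq C.
  have [//|le] := clos_size N us0.
  have := leq_trans (leq_trans le (uniq_leq_size uC CD)) leN.
  by rewrite -{2}(add0n N) leq_add2r leqNgt s0n.
split=> //; first exact: clos_sub.
move=> A A0 H x xC; suff [] : A x /\ x \in C by [].
apply: (@clos_inv (fun x => A x /\ x \in C) _ _ _ _ _ xC) => [y y0|y z [Ay yC] zy]; split.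
- exact: A0.
- exact: clos_sub.
- exact: (H y).
- exact: (cC y).
Qed.
End Closure.

(** The type [T] may carry more darts than [D]: the permutations are compared on [D] only, and
    [genus0] accounts for several components. Planarity then passes to stable subsets of [D] without
    any new counting. *)
Definition planar_on (D : seq nat) (s a : nat -> nat) : Prop :=
  exists (T : finType) (h : T -> nat) (u v : {perm T}),
  [/\ injective h, {in D, forall x, exists i, h i = x},
      forall i, h i \in D -> s (h i) = h (u i) /\ a (h i) = h (v i)
    & genus0 u v].

Record rotsys (D : seq nat) (s a : nat -> nat) : Prop := RotSys {
  rs_uniq : uniq D;
  rs_s : perm_on D s;
  rs_a : {in D, forall x, a x \in D};
  rs_inv : {in D, forall x, a (a x) = x};
  rs_nfix : {in D, forall x, a x != x};
  rs_planar : planar_on D s a }.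

Lemma rotsys_eq D s s' a : {in D, s =1 s'} -> rotsys D s a -> rotsys D s' a.
Proof.
move=> e [uD ps aD aI aF [T [h [u [v [hI hD hs g]]]]]]; split=> //.
  exact: perm_on_eq ps.
exists T, h, u, v; split=> // i iD; rewrite -e //; exact: hs.
Qed.

Lemma rotsys_sub D E s a : uniq E -> {subset E <= D} ->
  {in E, forall x, s x \in E} -> {in E, forall x, a x \in E} ->
  rotsys D s a -> rotsys E s a.
Proof.
move=> uE sE sE' aE [uD [_ sI] aD aI aF [T [h [u [v [hI hD hs g]]]]]]; split=> //.
- by split=> // x y /sE xD /sE; apply: sI.
- by move=> x /sE; apply: aI.
- by move=> x /sE; apply: aF.
by exists T, h, u, v; split=> // [x /sE /hD|i /sE /hs].
Qed.

Lemma rotsys_perm_a D s a : rotsys D s a -> perm_on D a.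
Proof.
move=> [_ _ aD aI _ _]; split=> // x y xD yD e.
by rewrite -(aI x) // e aI.
Qed.

Lemma iter_perm_lift (T : finType) (h : T -> nat) (w : {perm T}) (D : seq nat) F i n :
  (forall k, h k \in D -> F (h k) = h (w k)) -> {in D, forall z, F z \in D} ->
  h i \in D -> h ((w ^+ n)%g i) = iter n F (h i).
Proof.
move=> FE FD iD; rewrite permX; elim: n => //= n IH; rewrite -IH FE // IH.
by elim: n {IH} => //= n; apply: FD.
Qed.

(** * Composing a planar rotation with a transposition *)

Section Split.
Variables (D : seq nat) (s a s' : nat -> nat) (x y n : nat).
Hypotheses (rs : rotsys D s a) (xD : x \in D) (xy : x != y) (it : iter n s x = y).
Hypothesis s'E : {in D, forall z,
  s' z = if z == x then s y else if z == y then s x else s z}.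

Let yD : y \in D.
Proof. by rewrite -it; elim: (n) => //= k; apply: (proj1 (rs_s rs)). Qed.

Let perm_s' : perm_on D s'.
Proof. by apply: perm_on_eq (perm_on_swap (rs_s rs) xD yD) => z zD; rewrite s'E. Qed.

Let setting : exists (T : finType) (h : T -> nat) (u v : {perm T}) (i j : T),
  [/\ injective h, {in D, forall z, exists k, h k = z},
      forall k, h k \in D -> [/\ s (h k) = h (u k), a (h k) = h (v k) &
         s' (h k) = h ((tperm i j * u)%g k)],
      h i = x /\ h j = y &
      [/\ genus0 (tperm i j * u)%g v, genus0 u v &
        (j \in gclass (tperm i j * u)%g v i) = (j \notin porbit (u * v)%g i)]].
Proof.
have [T [h [u [v [hI hD hs g]]]]] := rs_planar rs.
have [i ei] := hD x xD; have [j ej] := hD y yD.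
have ij : i != j by apply: contraNneq xy => e; rewrite -ei -ej e.
have ju : j \in porbit u i.
  apply/porbitP; exists n; apply: hI.
  rewrite (iter_perm_lift n (fun k kD => proj1 (hs k kD)) (proj1 (rs_s rs))) ei //.
  by rewrite ej it.
have [g' e'] := genus0_split g ij ju.
exists T, h, u, v, i, j; split=> // k kD; have [e1 e2] := hs k kD; split=> //.
rewrite s'E // permM -ei -ej !(inj_eq hI).
case: tpermP => [->|->|]; rewrite ?eqxx.
- by rewrite (proj1 (hs _ _)) // ej.
- by rewrite eq_sym (negPf ij) (proj1 (hs _ _)) // ei.
by move=> /eqP/negPf-> /eqP/negPf->.
Qed.

Lemma rotsys_split : rotsys D s' a.
Proof.
have [uD ps aD aI aF _] := rs; split=> //.
have [T [h [u [v [i [j [hI hD hs _ [g _ _]]]]]]]] := setting.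
by exists T, h, (tperm i j * u)%g, v; split=> // k /hs[].
Qed.

Let face z := a (s z).

Let faceD : {in D, forall z, face z \in D}.
Proof. by move=> z zD; apply: (rs_a rs); apply: (proj1 (rs_s rs)). Qed.

(** Faces appear here as cycles of [a (s z)], matching the product [u * v]; they are conjugate by
    [s] to those of [mphi]. The separating predicate is the component of [x] after the split. *)
Lemma split_disconnect m : iter m (fun z => a (s z)) x = y ->
  exists A : pred nat, [/\ A x, ~~ A y & {in D, forall z, A (s' z) = A z /\ A (a z) = A z}].
Proof.
have [T [h [u [v [i [j [hI hD hs [hi hj] [_ _ e]]]]]]]] := setting.
move=> itm; set G := gclass (tperm i j * u)%g v i in e.
exists (fun z => [exists k in G, h k == z]).
have AE k : [exists k' in G, h k' == h k] = (k \in G).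
  apply/exists_inP/idP => [[k' kG /eqP/hI <-//]|kG]; by exists k.
split; first by rewrite -hi AE gclass_refl.
  rewrite -hj AE e negbK; apply/porbitP; exists m; apply: hI.
  rewrite (@iter_perm_lift _ _ _ D face) ?hi //; first by rewrite hj -itm.
  move=> k kD; rewrite /face permM; have [sk _ _] := hs k kD; rewrite sk.
  by have /hs[] : h (u k) \in D by rewrite -sk; apply: (proj1 (rs_s rs)).
move=> z zD; have [k ek] := hD z zD; rewrite -ek in zD *.
have [_ -> ->] := hs k zD.
by rewrite !AE /G gclassL gclassR.
Qed.

(** The split merges the distinct faces of [x] and [y], so both stay in one component, which is
    contained in every stable set around [x]. *)
Lemma split_connect (A : pred nat) : (forall m, iter m (fun z => a (s z)) x <> y) ->
  {in D, forall z, A z -> A (s' z) /\ A (a z)} -> A x -> A y.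
Proof.
have [T [h [u [v [i [j [hI hD hs [hi hj] [_ _ e]]]]]]]] := setting.
move=> nit cA Ax.
have jG : j \in gclass (tperm i j * u)%g v i.
  rewrite e; apply/negP => /porbitP[m em]; apply: (nit m).
  rewrite -hj em (@iter_perm_lift _ _ _ D face) ?hi //.
  move=> k kD; rewrite /face permM; have [sk _ _] := hs k kD; rewrite sk.
  by have /hs[] : h (u k) \in D by rewrite -sk; apply: (proj1 (rs_s rs)).
have /subsetP/(_ j jG) : gclass (tperm i j * u)%g v i \subset [set k | (h k \in D) && A (h k)].
  have [s'D _] := perm_s'.
  apply: gclass_min; last by rewrite inE hi xD.
    move=> k; rewrite !inE => /andP[kD Ak]; have [_ _ <-] := hs k kD.
    by rewrite s'D //= (proj1 (cA _ kD Ak)).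
  move=> k; rewrite !inE => /andP[kD Ak]; have [_ <- _] := hs k kD.
  by rewrite (rs_a rs) //= (proj2 (cA _ kD Ak)).
by rewrite inE hj => /andP[].
Qed.

End Split.

(** * One-corner components *)

Lemma rotsys_face D s a : rotsys D s a -> perm_on D (fun z => s (a z)).
Proof.
move=> rs; have [sD sI] := rs_s rs; have [aD aI] := rotsys_perm_a rs.
split=> [x xD|x y xD yD /sI/aI]; first exact/sD/aD.
by move=> H; apply: H; rewrite ?aD.
Qed.

Lemma eq_in_fpath (f g : nat -> nat) x p : {in belast x p, f =1 g} ->
  fpath f x p = fpath g x p.
Proof.
elim: p x => //= y p IH x e; rewrite e ?mem_head // IH // => z zp.
by apply: e; rewrite inE zp orbT.
Qed.

Lemma last_notin_belast (x : nat) p : uniq (x :: p) ->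
  {in belast x p, forall z, z != last x p}.
Proof.
rewrite lastI rcons_uniq => /andP[nl _] z zp.
by apply: contraNneq nl => <-.
Qed.

Lemma fcycle_cut (f g : nat -> nat) x p : uniq (x :: p) -> fpath f x p ->
  {in x :: p, forall z, g z = if z == last x p then x else f z} -> fcycle g (x :: p).
Proof.
move=> u fp e /=; rewrite rcons_path /= (e _ (mem_last _ _)) !eqxx andbT.
rewrite -(@eq_in_fpath f) // => z zp.
rewrite e ?(negPf (last_notin_belast u zp)) //.
by rewrite lastI mem_rcons inE zp orbT.
Qed.

(** * Cutting a vertex at two of its corners *)

Section CutCycle.
Variables (D : seq nat) (s a : nat -> nat) (b : nat) (R : seq nat) (c : nat) (Q : seq nat).
Hypotheses (rs : rotsys D s a) (cyc : fcycle s (b :: R ++ c :: Q)).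
Hypotheses (unq : uniq (b :: R ++ c :: Q)) (subD : {subset b :: R ++ c :: Q <= D}).
(** Cutting at the corners [b] and [c] amounts to swapping the images of the two last darts [x] and
    [y], so it is a split by a transposition. *)
Let s' z := if z == last b R then b else if z == last c Q then c else s z.
Let x := last b R.
Let y := last c Q.

Let parts : [/\ fpath s b R, s x = c, fpath s c Q & s y = b].
Proof.
move: cyc; rewrite /= rcons_cat cat_path /= rcons_path.
by case/and4P => ? /eqP ? ? /eqP ?.
Qed.

Let uR : uniq (b :: R).
Proof. by move: unq; rewrite -cat_cons cat_uniq => /andP[]. Qed.
Let uQ : uniq (c :: Q).
Proof. by move: unq; rewrite -cat_cons cat_uniq => /and3P[]. Qed.
Let RQ z : z \in b :: R -> z \notin c :: Q.
Proof.
move: unq; rewrite -cat_cons cat_uniq => /and3P[_ /hasPn H _] zR.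
by apply/negP => /H; rewrite zR.
Qed.

Let xy : x != y.
Proof. by apply: contraTneq (mem_last b R) => e; apply/negP => /RQ; rewrite -/x e mem_last. Qed.

Let xD : x \in D. Proof. by apply: subD; rewrite -cat_cons mem_cat mem_last. Qed.
Let yD : y \in D. Proof. by apply: subD; rewrite -cat_cons mem_cat mem_last orbT. Qed.

Lemma cut_fcycleL : fcycle s' (b :: R).
Proof.
have [fp _ _ _] := parts; apply: fcycle_cut fp _ => // z zR.
rewrite /s'; case: eqP => // _; case: eqP => // zy.
by have := RQ zR; rewrite zy mem_last.
Qed.

Lemma cut_fcycleR : fcycle s' (c :: Q).
Proof.
have [_ _ fp _] := parts; apply: fcycle_cut fp _ => // z zQ.
rewrite /s'; case: eqP => // zx; case: eqP => // _.
  by move: zQ; rewrite zx => zQ; have := RQ (mem_last b R); rewrite zQ.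
by move: zQ; rewrite zx => zQ; have := RQ (mem_last b R); rewrite zQ.
Qed.

Let reach_xy : exists n, iter n s x = y.
Proof.
have [n en] : exists n, iter n s b = x.
  by apply: fcycle_reach cyc _; rewrite -cat_cons mem_cat mem_last.
have [m em] : exists m, iter m s b = y.
  by apply: fcycle_reach cyc _; rewrite -cat_cons mem_cat mem_last orbT.
have bD : b \in D by apply: subD; rewrite mem_head.
have [k ek] := perm_on_iter_sym (rs_uniq rs) (rs_s rs) bD en.
by exists (m + k); rewrite iterD ek.
Qed.

Let s'E : {in D, forall z, s' z = if z == x then s y else if z == y then s x else s z}.
Proof. by have [_ -> _ ->] := parts. Qed.

Lemma cut_rotsys : rotsys D s' a.
Proof. by have [n it] := reach_xy; apply: (rotsys_split rs xD xy it s'E). Qed.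

(** Conjugation by [s] passes from the face through the dart [x] to the face through the corner
    [c = s x]. *)
Let s_face m : s (iter m (fun z => a (s z)) x) = iter m (fun z => s (a z)) c.
Proof. by elim: m => [|m /= ->] //=; have [] := parts. Qed.

Let same_face m : iter m (fun z => s (a z)) c = b -> iter m (fun z => a (s z)) x = y.
Proof.
move=> e; have [sD sI] := rs_s rs; apply: sI => //.
  elim: m {e} => //= m IH; apply: (rs_a rs); exact: sD.
by rewrite s_face e; have [] := parts.
Qed.

Lemma cut_disconnect m : iter m (fun z => s (a z)) b = c ->
  exists A : pred nat, [/\ {in b :: R, forall z, A z}, {in c :: Q, forall z, ~~ A z}
    & {in D, forall z, A (s' z) = A z /\ A (a z) = A z}].
Proof.
have bD : b \in D by apply: subD; rewrite mem_head.
move=> /(perm_on_iter_sym (rs_uniq rs) (rotsys_face rs) bD)[k /same_face e].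
have [n it] := reach_xy.
have [A [Ax Ay cA]] := split_disconnect rs xD xy it s'E e.
have itA q z : z \in D -> A (iter q s' z) = A z.
  move=> zD; elim: q => //= q <-; apply: (proj1 (cA _ _)).
  by elim: q => //= q; apply: (proj1 (rs_s cut_rotsys)).
have cD : c \in D by apply: subD; rewrite -cat_cons mem_cat mem_head orbT.
have Ec : s' y = c.
  by rewrite /s' eqxx; case: eqP => // yx; move: xy; rewrite /x -yx eqxx.
exists A; split=> // z.
  move=> /(fcycle_reach cut_fcycleL)[j <-]; rewrite itA //.
  by rewrite -[b](_ : s' x = b) ?(proj1 (cA _ xD)) // /s' eqxx.
move=> /(fcycle_reach cut_fcycleR)[j <-]; rewrite itA //.
by rewrite -Ec (proj1 (cA _ yD)).
Qed.

Lemma cut_connect (A : pred nat) : (forall m, iter m (fun z => s (a z)) b <> c) ->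
  {in D, forall z, A z -> A (s' z) /\ A (a z)} -> A b -> A c.
Proof.
move=> nit cA Ab; have bD : b \in D by apply: subD; rewrite mem_head.
have cD : c \in D by apply: subD; rewrite -cat_cons mem_cat mem_head orbT.
have [n it] := reach_xy.
have [s'D _] := rs_s cut_rotsys.
have Ec : s' y = c.
  by rewrite /s' eqxx; case: eqP => // yx; move: xy; rewrite /x -yx eqxx.
have itA k : A (iter k s' b) && (iter k s' b \in D).
  elim: k => /= [|k /andP[Ak kD]]; first by rewrite Ab.
  by rewrite s'D // (proj1 (cA _ kD Ak)).
have [k ek] : exists k, iter k s' b = x.
  by apply: fcycle_reach cut_fcycleL _; apply: mem_last.
have /andP[Ax _] := itA k; rewrite ek in Ax.
rewrite -Ec; apply: (proj1 (cA _ yD _)).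
apply: (split_connect rs xD xy it s'E) cA Ax => m em.
have : iter m (fun z => s (a z)) c = b by rewrite -s_face em; have [] := parts.
move=> /(perm_on_iter_sym (rs_uniq rs) (rotsys_face rs) cD)[j]; exact: nit.
Qed.
End CutCycle.

(** Connectedness is recorded as an induction principle for stable predicates, the form in which it
    is used. The empty map is excluded, because the root has to be a dart. *)
Definition sound (M : cmap) : Prop :=
  [/\ rotsys (md M) (msg M) (mal M), mroot M \in md M
    & forall A : pred nat, A (mroot M) ->
      {in md M, forall z, A z -> A (msg M z) /\ A (mal M z)} -> {in md M, forall z, A z}].

Definition vroot (M : cmap) : seq nat := porb (size (md M)) (msg M) (mroot M).

Definition one_corner (U : cmap) : Prop :=
  sound U /\ {in vroot U, forall x, x \in outer_face U -> x = mroot U}.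

Lemma outerP M x : sound M ->
  reflect (exists n, iter n (mphi M) (mroot M) = x) (x \in outer_face M).
Proof.
move=> [rs rD _].
exact: (mem_porb x (rs_uniq rs) (rotsys_face rs) rD (leqnn _)).
Qed.

Lemma vrootP M : sound M -> exists p, [/\ vroot M = mroot M :: p,
  fcycle (msg M) (mroot M :: p), uniq (mroot M :: p) & {subset mroot M :: p <= md M}].
Proof. by move=> [rs rD _]; apply: porbP (rs_uniq rs) (rs_s rs) rD (leqnn _). Qed.

Lemma cut_sg_fcycle s b R : uniq (b :: R) -> fpath s b R ->
  fcycle (cut_sg s (b :: R)) (b :: R).
Proof. by move=> u fp; apply: fcycle_cut fp _ => // z zR; rewrite /cut_sg zR. Qed.

Section Component.
Variables (M : cmap) (b : nat) (R : seq nat).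
Hypotheses (sM : sound M) (uR : uniq (b :: R)) (pR : fpath (msg M) b R).
Hypothesis RD : {subset b :: R <= md M}.
Let U := comp M (b :: R).

Lemma comp_closure : [/\ uniq (md U), {subset b :: R <= md U}, {subset md U <= md M},
  {in md U, forall x, mal M x \in md U /\ msg U x \in md U} &
  forall A : nat -> Prop, {in b :: R, forall x, A x} ->
    (forall x, x \in md U -> A x -> A (mal M x) /\ A (msg U x)) -> {in md U, forall x, A x}].
Proof.
have [rs rD _] := sM.
have [|u i o st m] := @closP (md M) (fun x => [:: mal M x; cut_sg (msg M) (b :: R) x])
    (b :: R) (size (md M)) uR RD isT _ (leqnn _).
  move=> x xD y; rewrite !inE => /orP[]/eqP->; first exact: (rs_a rs).
  rewrite /cut_sg; case: ifP => xR; last exact: (proj1 (rs_s rs)).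
  case: ifP => _ /=; last exact: (proj1 (rs_s rs)).
  by apply: RD; rewrite mem_head.
split=> //.
  by move=> x xU; split; apply: (st x xU); rewrite !inE eqxx ?orbT.
move=> A AR H; apply: m => // x y xU Ax; have [A1 A2] := H x xU Ax.
by rewrite !inE => /orP[]/eqP->.
Qed.

Lemma comp_vroot : vroot U = b :: R.
Proof.
have [u i _ _ _] := comp_closure; apply: porb_cycle => //; first exact: cut_sg_fcycle.
exact: (uniq_leq_size uR i).
Qed.

(** On all darts of [M] the function [msg U] may fail to be injective. Planarity is therefore taken
    from a rotation [s'] of [M] that agrees with it on [U]: [msg M] if the run is a whole vertex,
    the cut rotation otherwise. *)
Lemma comp_sound s' : rotsys (md M) s' (mal M) -> {in md U, s' =1 msg U} -> sound U.
Proof.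
move=> rs e; have [u i o st m] := comp_closure; split.
- apply: (rotsys_eq e); apply: (rotsys_sub u o _ _ rs) => x xU; last by have [] := st x xU.
  by rewrite e //; have [] := st x xU.
- by apply: i; rewrite mem_head.
move=> A Ab cA x; apply: (m A) => [z|z zU Az]; last by have [] := cA z zU Az.
move=> /(fcycle_reach (cut_sg_fcycle uR pR))[n <-].
have : b \in md U by apply: i; rewrite mem_head.
move=> bU; suff /andP[] : A (iter n (msg U) b) && (iter n (msg U) b \in md U) by [].
elim: n => /= [|n /andP[An nU]]; first by rewrite bU Ab.
by rewrite (proj2 (st _ nU)) (proj1 (cA _ nU An)).
Qed.

(** A face step of [U] from an outer corner of [M] either is a face step of [M] or leads to [b],
    itself outer. So the root face of [U] stays in the outer face of [M]. *)
Lemma comp_one_corner : sound U -> b \in outer_face M ->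
  {in R, forall x, x \notin outer_face M} -> one_corner U.
Proof.
move=> sU bo Ro; split=> // x; rewrite comp_vroot inE => /predU1P[//|xR] /(outerP _ sU)[n].
move=> e; case/negP: (Ro x xR); rewrite -e.
elim: n {e} => //= n IH; rewrite {1}/mphi /= /cut_sg.
have step : msg M (mal M (iter n (mphi U) b)) \in outer_face M.
  have [m <-] := outerP _ sM IH.
  by apply/(outerP _ sM); exists m.+1.
by case: ifP => // _; case: ifP.
Qed.
End Component.

Lemma comp_full M b R : sound M -> fcycle (msg M) (b :: R) -> uniq (b :: R) ->
  {subset b :: R <= md M} -> sound (comp M (b :: R)).
Proof.
move=> sM cyc u RD; have [rs _ _] := sM.
move: (cyc); rewrite /= rcons_path => /andP[fp /eqP l].
apply: (comp_sound sM u fp RD rs) => z _ /=.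
by rewrite /cut_sg; case: ifP => // _; case: eqP => // ->.
Qed.

(** Two outer corners lie on one face, so the cut separates [b :: R] from [c :: Q]. The component
    then avoids [c :: Q], the only place where [cut_sg] can differ from the planar cut rotation. *)
Lemma comp_rest M b R c Q : sound M -> fcycle (msg M) (b :: R ++ c :: Q) ->
  uniq (b :: R ++ c :: Q) -> {subset b :: R ++ c :: Q <= md M} ->
  b \in outer_face M -> c \in outer_face M ->
  sound (comp M (b :: R)) /\ {in md (comp M (b :: R)), forall z, z \notin c :: Q}.
Proof.
move=> sM cyc u RD bo co; have [rs _ _] := sM.
have [m em] : exists m, iter m (mphi M) b = c.
  have [n en] := outerP _ sM bo; have [k ek] := outerP _ sM co.
  have rD : mroot M \in md M by case: sM.
  have [j ej] := perm_on_iter_sym (rs_uniq rs) (rotsys_face rs) rD en.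
  by exists (k + j); rewrite iterD ej ek.
have [A [AR AQ cA]] := cut_disconnect rs cyc u RD em.
have uR : uniq (b :: R) by move: u; rewrite -cat_cons cat_uniq => /andP[].
have pR : fpath (msg M) b R by move: cyc; rewrite /= rcons_cat cat_path => /andP[].
have RD' : {subset b :: R <= md M}.
  by move=> z zR; apply: RD; rewrite -cat_cons mem_cat zR.
have [uU i o st min] := comp_closure sM uR RD'.
have e z : z \notin c :: Q -> (if z == last b R then b else
    if z == last c Q then c else msg M z) = cut_sg (msg M) (b :: R) z.
  move=> zQ; rewrite /cut_sg.
  have -> : (z == last c Q) = false by apply: contraNF zQ => /eqP->; exact: mem_last.
  case: (z =P last b R) => [->|zl] /=; rewrite ?mem_last //.
  by case: ifP => // _; case: eqP.
have UA : {in md (comp M (b :: R)), forall z, A z}.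
  apply: min => // z zU Az; have [A1 A2] := cA z (o z zU); split; first by rewrite A2.
  rewrite /= -e; first by rewrite A1.
  by apply/negP => /AQ; rewrite Az.
have UQ : {in md (comp M (b :: R)), forall z, z \notin c :: Q}.
  by move=> z /UA Az; apply/negP => /AQ; rewrite Az.
split=> //; apply: (comp_sound sM uR pR RD' (cut_rotsys rs cyc u RD)).
by move=> z /UQ /e ->.
Qed.

Lemma runsP (p : pred nat) x s : p x ->
  flatten (runs p (x :: s)) = x :: s /\
  {in runs p (x :: s), forall R, exists b R', [/\ R = b :: R', p b & {in R', forall z, ~~ p z}]}.
Proof.
move=> px; pose good R := exists b R', [/\ R = b :: R', p b & {in R', forall z, ~~ p z}].
(* Reading from the right, [R0] is the run whose leading dart has not been met yet; [Rs] holds the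
   finished runs. *)
suff H t : exists R0 Rs, [/\ foldr (runs_step p) [:: [::]] t = R0 :: Rs,
    R0 ++ flatten Rs = t, {in R0, forall z, ~~ p z} & {in Rs, forall R, good R}].
  have [R0 [Rs [/= e1 e2 e3 e4]]] := H s.
  by rewrite /runs /= e1 /= px /= e2; split=> // R; rewrite inE => /predU1P[->|/e4 //]; exists x, R0.
elim: t => [|y t [R0 [Rs [/= -> e2 e3 e4]]]]; first by exists [::], [::].
rewrite /=; case: ifP => py; [exists [::], ((y :: R0) :: Rs)|exists (y :: R0), Rs].
  split=> //=; first by rewrite e2.
  by move=> R; rewrite inE => /predU1P[->|/e4 //]; exists y, R0.
split=> //=; first by rewrite e2.
by move=> z; rewrite inE => /predU1P[->|/e3 //]; rewrite py.
Qed.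

Record run_spec (M : cmap) (R : seq nat) : Prop := RunSpec {
  run_cons : exists b R', R = b :: R';
  run_corner : one_corner (comp M R);
  run_vroot : vroot (comp M R) = R;
  run_sub : {subset md (comp M R) <= md M};
  run_meet : {in md (comp M R), forall z, z \in vroot M -> z \in R} }.

(** Once the root vertex is rotated so that [R] comes first, the rest [Q] is empty or starts with an
    outer corner; these are the cases [comp_full] and [comp_rest]. *)
Lemma run_specP M L1 R L2 : sound M ->
  L1 ++ R :: L2 = runs (fun x => x \in outer_face M) (vroot M) -> run_spec M R.
Proof.
move=> sM eqL; have [p [ev cyc u sub]] := vrootP sM.
have ro : mroot M \in outer_face M by apply/(outerP _ sM); exists 0.
have [ef good] := runsP p (ro : (fun x => x \in outer_face M) (mroot M)).
rewrite -ev -eqL in ef good.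
have inL : {subset L1 ++ L2 <= L1 ++ R :: L2}.
  by move=> Q; rewrite !mem_cat inE => /orP[->|->]; rewrite ?orbT.
have [b [R' [eR bo R'o]]] : exists b R', [/\ R = b :: R', b \in outer_face M
    & {in R', forall z, z \notin outer_face M}].
  by apply: good; rewrite mem_cat mem_head orbT.
pose Q := flatten L2 ++ flatten L1.
have er : rot (size (flatten L1)) (mroot M :: p) = R ++ Q.
  by rewrite -ev -ef flatten_cat /= rot_size_cat -catA.
have cyc' : fcycle (msg M) (R ++ Q) by rewrite -er rot_cycle.
have u' : uniq (R ++ Q) by rewrite -er rot_uniq.
have memE z : (z \in R ++ Q) = (z \in vroot M) by rewrite -er mem_rot ev.
have sub' : {subset R ++ Q <= md M} by move=> z; rewrite memE ev; apply: sub.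
have uR : uniq R by move: u'; rewrite cat_uniq => /andP[].
have RD : {subset R <= md M} by move=> z zR; apply: sub'; rewrite mem_cat zR.
have pR : fpath (msg M) b R'.
  move: cyc'; rewrite eR /=; case: (Q) => [|c Q']; first by rewrite cats0 rcons_path => /andP[].
  by rewrite rcons_cat cat_path => /andP[].
have [sU nQ] : sound (comp M R) /\ {in md (comp M R), forall z, z \notin Q}.
  case eQ: Q => [|c Q']; last first.
    have co : c \in outer_face M.
      have : {in L2 ++ L1, forall R, exists b R', [/\ R = b :: R', b \in outer_face M
         & {in R', forall z, z \notin outer_face M}]}.
        by move=> S SL; apply/good/inL; rewrite mem_cat orbC -mem_cat.
      move: eQ; rewrite /Q -flatten_cat; case: (L2 ++ L1) => //= S L e H.
      have [b1 [S1 [e1 o1 _]]] := H S (mem_head _ _).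
      by move: e; rewrite e1 => -[<-].
    by rewrite eQ eR in cyc' u' sub' *; apply: comp_rest.
  split=> //; rewrite eQ cats0 in cyc' u' sub'.
  by rewrite eR in cyc' u' sub' *; apply: comp_full.
rewrite eR in uR RD sU pR *.
have [uU i o st min] := comp_closure sM uR RD.
split=> //.
- by exists b, R'.
- exact: (comp_one_corner sM uR pR RD sU).
- exact: (comp_vroot sM uR pR RD).
by move=> z zU; rewrite -memE mem_cat -eR in zU * => /orP[//|zQ]; case/negP: (nQ z zU).
Qed.

(** The complement of [comp M R] is stable under the moves of [comp M R']: a rotation step of [M]
    into [comp M R] from outside lands in [R], hence starts at the root vertex, that is in [R'], but
    there the run is closed on itself. *)
Lemma comp_disjoint M R R' : sound M -> run_spec M R -> run_spec M R' ->
  {subset R <= vroot M} -> {subset R' <= vroot M} -> {in R', forall z, z \notin R} ->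
  {in md (comp M R'), forall z, z \notin md (comp M R)}.
Proof.
move=> sM [_ [sU _] vR oR mR] [[b' [S' eR']] [sU' _] vR' oR' mR'] sR sR' dR.
have [p [ev cyc u sub]] := vrootP sM.
have [rs _ _] := sM; have [sD sI] := rs_s rs.
have [q [eq cyc' uq subq]] := vrootP sU'; have [q2 [eq2 cyc2 _ _]] := vrootP sU.
have [rU _ _] := sU.
rewrite -eq vR' in cyc' uq subq; rewrite -eq2 vR in cyc2.
have R'D : {subset R' <= md M} by move=> z /sR'; rewrite ev; apply: sub.
rewrite eR' in uq R'D; have [uU i o st min] := comp_closure sM uq R'D; rewrite -eR' in min st i.
have R'U : {in R', forall z, z \notin md (comp M R)}.
  by move=> z zR'; apply/negP => /mR/(_ (sR' z zR')) zR; case/negP: (dR z zR').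
apply: min => // z zU' zU; split.
  apply: contraNN zU => zU.
  by rewrite -(rs_inv rs (oR' z zU')); apply: (rs_a rU zU).
case: (boolP (z \in R')) => zR'; first exact: R'U (mem_fcycle cyc' zR').
have zv : z \notin vroot M by apply: contraNN zR'; apply: mR'.
have -> : msg (comp M R') z = msg M z by rewrite /= /cut_sg (negPf zR').
have zD := oR' z zU'.
apply/negP => /(perm_on_surj (rs_uniq rU) (rs_s rU))[w wU].
case: (boolP (w \in R)) => wR.
  have /sR := mem_fcycle cyc2 wR; move=> /[swap] -> szv.
  have [m em] := perm_on_iter_sym (rs_uniq rs) (rs_s rs) zD (erefl (iter 1 (msg M) z)).
  case/negP: zv; rewrite -em ev; apply: fcycle_iter => //; by rewrite -ev.
rewrite /= /cut_sg (negPf wR) => /(sI _ _ (oR w wU) zD) wz.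
by rewrite -wz wU in zU.
Qed.

Lemma compsP M : sound M -> exists Rs : seq (seq nat),
  [/\ comps M = rev [seq comp M R | R <- Rs], flatten Rs = vroot M,
      {in Rs, forall R, run_spec M R}
    & pairwise (fun R R' => all (fun z => z \notin md (comp M R)) (md (comp M R'))) Rs].
Proof.
move=> sM; have [p [ev cyc u sub]] := vrootP sM.
have ro : mroot M \in outer_face M by apply/(outerP _ sM); exists 0.
set Rs := runs (fun x => x \in outer_face M) (vroot M).
have [ef good] := runsP p (ro : (fun x => x \in outer_face M) (mroot M)).
rewrite -ev -/Rs in ef good.
have spec : {in Rs, forall R, run_spec M R}.
  move=> R RL; have [L1 [L2 e]] : exists L1 L2, L1 ++ R :: L2 = Rs.
    by move: RL; clear; move: Rs => L /splitPr[L1 L2]; exists L1, L2.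
  exact: (run_specP sM e).
exists Rs; split=> //.
  rewrite /comps -map_rev; case: eqP => // e; by have [_] := sM; rewrite e.
have uF : uniq (flatten Rs) by rewrite ef ev.
have subF : {in Rs, forall R, {subset R <= vroot M}}.
  by move=> R RL z zR; rewrite -ef; apply/flattenP; exists R.
elim: (Rs) spec uF subF => //= R L IH spec; rewrite cat_uniq => /and3P[uR /hasPn dis uL] subF.
rewrite IH // ?andbT; first last.
- by move=> S SL; apply: subF; rewrite inE SL orbT.
- by move=> S SL; apply: spec; rewrite inE SL orbT.
apply/allP => S SL; apply/allP; apply: comp_disjoint => //.
- by apply: spec; rewrite mem_head.
- by apply: spec; rewrite inE SL orbT.
- by apply: subF; rewrite mem_head.
- by apply: subF; rewrite inE SL orbT.
by move=> z zS; apply: dis; apply/flattenP; exists S.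
Qed.

(** * Removing the root edge *)

(** The rotation of an intermediate map between [U] and [Pi U]: the root dart is left alone, the
    other darts of the root vertex close up. One step of the walk turns [U] into this, up to the
    exit from the root dart. *)
Definition detach (U : cmap) (x : nat) : nat :=
  if x == mroot U then x
  else if msg U x == mroot U then msg U (mroot U) else msg U x.

Section Detach.
Variable U : cmap.
Hypothesis oU : one_corner U.
Let d := mroot U.
Let p := mal U d.
Let s := msg U.
Let s2 := detach U.

Let rs : rotsys (md U) s (mal U). Proof. by case: oU => -[]. Qed.
Let dU : d \in md U. Proof. by case: oU => -[]. Qed.
Let pU : p \in md U. Proof. exact: (rs_a rs). Qed.
Let pd : p != d. Proof. exact: (rs_nfix rs). Qed.
Let ap : mal U p = d. Proof. exact: (rs_inv rs). Qed.
Let sU : {in md U, forall x, s x \in md U}. Proof. by have [] := rs_s rs. Qed.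
Let sI : {in md U &, injective s}. Proof. by have [] := rs_s rs. Qed.
Let s2d : s2 d = d. Proof. by rewrite /s2 /detach eqxx. Qed.

(** Isolating [d] is a cut at [d] and the next corner [c]. As [d] is the only outer corner of the
    root vertex, [c] lies on another face and the cut keeps [U] connected. *)
Lemma detach_rotsys_connected : rotsys (md U) s2 (mal U) /\
  forall A : pred nat, A d -> {in md U, forall z, A z -> A (s2 z) /\ A (mal U z)} ->
  {in md U, forall z, A z}.
Proof.
have [[_ _ min] oc] := oU; have [sdU _] := oU.
have [J [ev cyc u sub]] := vrootP sdU.
case eJ: J => [|c Q]; subst J.
  have sd : s d = d by move: cyc => /= /andP[/eqP].
  have e : {in md U, s =1 s2}.
    move=> x xU; rewrite /s2 /detach -/d -/s; case: eqP => [->//|/eqP nx].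
    by case: eqP => // sx; rewrite sx sd.
  split; first exact: rotsys_eq e rs.
  by move=> A Ad cA; apply: min => // z zU Az; have := cA z zU Az; rewrite -e.
have [sd ls] : s d = c /\ s (last c Q) = d.
  by move: cyc => /= /andP[/eqP sd]; rewrite rcons_path => /andP[_ /eqP].
have lU : last c Q \in md U by apply: sub; rewrite inE mem_last orbT.
have e : {in md U, (fun z => if z == last d [::] then d else if z == last c Q then c else s z) =1 s2}.
  move=> x xU; rewrite /s2 /detach -/d -/s /=; case: eqP => // nx.
  rewrite sd; case: eqP => [->|nl]; first by rewrite ls eqxx.
  by case: eqP => // sx; case: nl; apply: sI => //; rewrite ls.
split; first exact: rotsys_eq e (cut_rotsys (R := [::]) rs cyc u sub).
move=> A Ad cA.
have Ac : A c.
  apply: (cut_connect (R := [::]) rs cyc u sub _ _ Ad) => [m em|z zU Az]; last first.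
    by have := cA z zU Az; rewrite -e.
  move: u => /= /andP[]; rewrite inE => /negP[]; rewrite eq_sym; apply/orP; left; apply/eqP.
  apply: oc; first by rewrite ev !inE eqxx orbT.
  by apply/(outerP _ sdU); exists m.
apply: min => // z zU Az; have [A1 A2] := cA z zU Az; split=> //.
move: A1; rewrite /s2 /detach -/d -/s; case: eqP => [->|_]; first by rewrite sd.
by case: eqP => // ->.
Qed.

Let rs2 : rotsys (md U) s2 (mal U). Proof. by case: detach_rotsys_connected. Qed.
Let min2 := proj2 detach_rotsys_connected.

Let D' := md (Pi U).
Let memD' x : (x \in D') = [&& x \in md U, x != d & x != p].
Proof. by rewrite mem_filter !inE negb_or andbC. Qed.

(** If [p] is alone at its vertex after detaching, [d] and [p] form a stable set, which is all of
    [U] by connectedness. *)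
Lemma detach_leaf : (md (Pi U) == [::]) = (s2 p == p).
Proof.
have [s2U s2I] := rs_s rs2; apply/eqP/eqP => [e|e].
  have := memD' (s2 p); rewrite /D' e in_nil s2U //=.
  case: eqP => [e'|_] /=; last by case: eqP.
  by case/eqP: pd; apply: s2I => //; rewrite s2d.
have H : {in md U, forall z, (z == d) || (z == p)}.
  apply: min2 => [|z zU /orP[]/eqP->]; rewrite ?eqxx //.
    by rewrite s2d -/p !eqxx orbT.
  by rewrite e ap !eqxx orbT.
apply/eqP/negPn/negP => /eqP; move eE: (md (Pi U)) => [|x E] // _.
have : x \in D' by rewrite /D' eE mem_head.
by rewrite memD' => /and3P[/H/orP[->//|->]]; rewrite ?andbF.
Qed.

(** A second cut, isolating [p], gives planarity; for connectedness a stable predicate on [Pi U] is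
    extended by [d] and [p]. The last clause says that [Pi U] is attached at the vertex of [p] with
    exit [p]. *)
Lemma Pi_sound : md (Pi U) != [::] -> [/\ sound (Pi U), mroot (Pi U) = s2 p &
  {in md (Pi U), forall x, s2 x = if msg (Pi U) x == mroot (Pi U) then p else msg (Pi U) x}].
Proof.
rewrite detach_leaf => np; have [s2U s2I] := rs_s rs2.
have [q [cyc u sub]] := perm_on_cycle (rs_uniq rs2) rs2.(rs_s) pU.
case: q cyc u sub => [|r Q] cyc u sub; first by move: cyc np; rewrite /= => /andP[->].
have [er lr] : s2 p = r /\ s2 (last r Q) = p.
  by move: cyc => /= /andP[/eqP sd]; rewrite rcons_path => /andP[_ /eqP].
(* With both ends of the root edge isolated, [s3] agrees with the [skip] rotation on the remaining
   darts. *)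
pose s3 z := if z == p then p else if s2 z == p then s2 p else s2 z.
have lU : last r Q \in md U by apply: sub; rewrite inE mem_last orbT.
have e : {in md U, (fun z => if z == last p [::] then p else if z == last r Q then r else s2 z) =1 s3}.
  move=> x xU; rewrite /s3 er /=; case: eqP => // nx.
  case: eqP => [->|nl]; first by rewrite lr eqxx.
  by case: eqP => // sx; case: nl; apply: s2I => //; rewrite lr.
have rs3 : rotsys (md U) s3 (mal U) by apply: rotsys_eq e (cut_rotsys (R := [::]) rs2 cyc u sub).
have [s3U s3I] := rs_s rs3.
have s3p : s3 p = p by rewrite /s3 eqxx.
have s3d : s3 d = d by rewrite /s3 s2d (eq_sym d) (negPf pd).
have aD' : {in D', forall x, mal U x \in D'}.
  move=> x; rewrite !memD' => /and3P[xU xd xp]; rewrite (rs_a rs) //=.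
  apply/andP; split; first by apply: contraNneq xp => e'; rewrite /p -e' (rs_inv rs).
  by apply: contraNneq xd => e'; rewrite -(rs_inv rs xU) e' ap.
have s3D' : {in D', forall x, s3 x \in D'}.
  move=> x; rewrite !memD' => /and3P[xU xd xp]; rewrite s3U //=.
  apply/andP; split; first by apply: contraNneq xd => e'; apply/eqP/s3I; rewrite // s3d.
  by apply: contraNneq xp => e'; apply/eqP/s3I; rewrite // s3p.
have rD' : r \in D'.
  rewrite memD' -er s2U //= np andbT; apply: contraNneq pd => e'.
  by apply/eqP/s2I; rewrite // s2d.
have skE : {in D', s3 =1 msg (Pi U)}.
  move=> x; rewrite memD' => /and3P[xU xd xp].
  rewrite /= /skip -/s -/d -/p !inE /s3 (negPf xp) /s2 /detach -/d -/s (negPf xd) (negPf pd).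
  case: (s x =P d) => [sx|sx] /=.
    rewrite sx; case: (s d =P d) => [sd|_] /=.
      by case/eqP: xd; apply: sI; rewrite // sx.
    case: (s d =P p) => [sd|//]; rewrite sd; case: eqP => // sp.
    by case/eqP: xp; apply: sI; rewrite // sx.
  case: (s x =P p) => [sx'|//]; rewrite sx'; case: (s p =P d) => [->//|_] /=.
  by case: (s p =P p) => // sp; rewrite !sp.
have mr : mroot (Pi U) = s2 p.
  have : s2 p \in D' by rewrite er.
  rewrite memD' /= /skip -/s -/d -/p !inE /s2 /detach -/d -/s (negPf pd) => /and3P[_].
  case: (s p =P d) => [->|_] /= ; first by move=> /negPf-> /negPf->.
  by move=> _ /negPf->.
split=> //; last first.
  move=> x xD'; rewrite -skE // mr; move: (xD'); rewrite memD' => /and3P[xU xd xp].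
  rewrite /s3 (negPf xp); case: (s2 x =P p) => [->|]; first by rewrite eqxx.
  by case: eqP => // /(s2I _ _ xU pU) xp'; rewrite xp' eqxx in xp.
split.
- apply: (rotsys_eq skE); apply: rotsys_sub rs3 => //; first by rewrite filter_uniq // (rs_uniq rs).
  by move=> x; rewrite memD' => /and3P[].
- by rewrite mr er.
move=> A Ar cA; rewrite mr er in Ar.
have H : {in md U, forall z, [|| z == d, z == p | (z \in D') && A z]}.
  apply: min2 => [|z zU]; first by rewrite eqxx.
  case/or3P => [/eqP->|/eqP->|/andP[zD' Az]].
  - by rewrite s2d -/p !eqxx orbT.
  - by rewrite er ap rD' Ar !eqxx !orbT.
  have [A1 A2] := cA z zD' Az; rewrite aD' // A2 !orbT; split=> //.
  move: (s3D' _ zD') (zD'); rewrite skE // memD' => s3z /and3P[_ _ zp].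
  move: s3z A1; rewrite -skE // /s3 (negPf zp); case: (s2 z =P p) => [->|_].
    by rewrite ?eqxx !orbT.
  by move=> -> ->; rewrite !orbT.
move=> z zD'; move: (zD'); rewrite memD' => /and3P[/H].
by move=> /[swap] /negPf-> /= /[swap] /negPf-> /= /andP[].
Qed.
End Detach.

(** * The contour walk *)

(** The cycle of [d] is opened where it would return to [d] and continued to [e]. This serves for
    vertex rotations and faces alike. *)
Lemma redirected_path (D : seq nat) (f g : nat -> nat) d e : uniq D -> perm_on D f ->
  d \in D -> {in D, forall x, g x = if f x == d then e else f x} ->
  exists p, [/\ fcycle f (d :: p), uniq (d :: p), {subset d :: p <= D}, fpath g d p
    & g (last d p) = e].
Proof.
move=> uD pf dD gE; have [p [cyc u sub]] := perm_on_cycle uD pf dD.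
move: (cyc); rewrite /= rcons_path => /andP[fp /eqP lp].
exists p; split=> //; last by rewrite gE ?sub ?mem_last // lp eqxx.
have [_ fI] := pf.
rewrite -(@eq_in_fpath f) // => z zp.
have zD : z \in D by apply: sub; rewrite lastI mem_rcons inE zp orbT.
rewrite gE //; case: eqP => // fz.
have := last_notin_belast u zp; case/eqP; apply: fI => //; [exact/sub/mem_last|by rewrite lp].
Qed.

(* Inside the map being walked, the root vertex of [M] is an interval of a larger
   vertex: [e] is the dart that follows its last dart there, i.e. the root dart
   of the next component or the dart leading back to the parent. *)
Definition attached (s : nat -> nat) (M : cmap) (e : nat) : Prop :=
  {in md M, forall x, s x = if msg M x == mroot M then e else msg M x}.

(** [clos] may list the same darts in another order, so equality of maps would be too strong a
    hypothesis. *)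
Lemma eq_outvU U V : sound U -> md U =i md V -> uniq (md V) -> mroot U = mroot V ->
  {in md U, mal U =1 mal V} -> {in md U, msg U =1 msg V} -> outvU U = outvU V.
Proof.
move=> [rs rU _] mE uV rE aE sE.
have sz : size (md U) = size (md V) by apply: perm_size; apply: uniq_perm => //; apply: rs_uniq rs.
have le : size (md U) <= size (md V) by rewrite sz.
have ph := rotsys_face rs.
have oE : outer_face U = outer_face V.
  rewrite /outer_face -rE; apply: (eq_porb (rs_uniq rs) ph) => // x xU.
  by rewrite /mphi aE // sE // -aE //; apply: (rs_a rs).
have [q [eq _ _ sq]] := porbP (rs_uniq rs) ph rU (leqnn _).
have eE x : x \in md U -> orep (size (md U)) (msg U) x = orep (size (md V)) (msg V) x.
  by move=> xU; apply: (eq_orep (rs_uniq rs) (rs_s rs)).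
have fE : {in outer_face U, forall x, x \in md U} by rewrite /outer_face eq.
rewrite /outvU -oE -rE; congr (size (undup _)).
have -> : [seq x <- outer_face U | orep (size (md U)) (msg U) x != orep (size (md U)) (msg U) (mroot U)]
   = [seq x <- outer_face U | orep (size (md V)) (msg V) x != orep (size (md V)) (msg V) (mroot U)].
  by apply: eq_in_filter => x /fE xU; rewrite !eE.
by apply/eq_in_map => x; rewrite mem_filter => /andP[_ /fE]; apply: eE.
Qed.

Section Walk.
Variable M0 : cmap.
Let D0 := md M0.
Let a := mal M0.
Let r0 := mroot M0.
Let N0 := size D0.
Hypothesis sM0 : sound M0.

Let rs0 : rotsys D0 (msg M0) a. Proof. by case: sM0. Qed.
Let r0D : r0 \in D0. Proof. by case: sM0. Qed.
Let uD0 : uniq D0. Proof. exact: rs_uniq rs0. Qed.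

Definition face (s : nat -> nat) (x : nat) := s (mal M0 x).

(* The last clause says that the walk up to now is a prefix of the outer
   contour of the current map, so that the current corner is outer. *)
Definition wf (st : wstate) : Prop :=
  [/\ perm_on (md M0) (ws_sg st),
      {in ws_vis st, forall x, x \in md M0 /\ mal M0 x \in ws_vis st}
    & exists n, iter n (face (ws_sg st)) (mroot M0) = ws_cur st /\
        forall i, i < n -> iter i (face (ws_sg st)) (mroot M0) \in ws_vis st].

Lemma wstep_visited st : wf st -> ws_cur st \in ws_vis st ->
  wstep M0 st = WState (ws_sg st) (ws_vis st) (ws_lab st) (ws_sg st (a (ws_cur st)))
  /\ wf (wstep M0 st).
Proof.
move=> [ps vD [n [e H]]] cv.
have E : wstep M0 st = WState (ws_sg st) (ws_vis st) (ws_lab st) (ws_sg st (a (ws_cur st))).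
  by rewrite /wstep cv.
split=> //; rewrite E; split=> //; exists n.+1; split=> /=; first by rewrite e.
by move=> i; rewrite ltnS leq_eqVlt => /predU1P[->|]; [rewrite e|apply: H].
Qed.

(** * One step of the walk along a new edge *)

Section NewEdge.
Variables (st : wstate) (U : cmap) (c2 : nat).
Let s := ws_sg st.
Let d := mroot U.
Hypotheses (wst : wf st) (oU : one_corner U) (aU : mal U = a).
Hypotheses (UD : {subset md U <= D0}) (dcur : ws_cur st = d).
Hypotheses (Uvis : {in md U, forall x, x \notin ws_vis st}).
Hypotheses (att : attached s U c2) (c2U : c2 \notin md U \/ c2 = d).

Let ps : perm_on D0 s. Proof. by case: wst. Qed.
Let sU : sound U. Proof. by case: oU. Qed.
Let rs : rotsys (md U) (msg U) a. Proof. by rewrite -aU; case: sU. Qed.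
Let dU : d \in md U. Proof. by case: sU. Qed.
Let pface : perm_on D0 (face s).
Proof.
have [sD sI] := ps; have [aD aI] := rotsys_perm_a rs0.
split=> [x xD|x y xD yD /sI/aI]; first exact/sD/aD.
by move=> H; apply: H; rewrite ?aD.
Qed.

Let outer := outer_face (CMap D0 s a r0).

Let outerE x : x \in outer <-> exists n, iter n (face s) d = x.
Proof.
have [_ _ [m [em _]]] := wst; rewrite dcur in em.
have [k ek] := perm_on_iter_sym uD0 pface r0D em.
have mE := mem_porb x uD0 pface r0D (leqnn N0).
split=> [/mE[n <-]|[n <-]]; first by exists (n + k); rewrite iterD ek.
by apply/(mem_porb _ uD0 pface r0D (leqnn N0)); exists (n + m); rewrite iterD em.
Qed.

(** From [d] the face of the current map follows the outer face of [U] until the step that would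
    close it at [d] leads to [c2] instead. *)
Let c2_outer : c2 \in outer.
Proof.
have gE : {in md U, forall x, face s x = if mphi U x == d then c2 else mphi U x}.
  by move=> x xU; rewrite /face att ?(rs_a rs) // /mphi aU.
have pU := rotsys_face rs; rewrite -aU in pU.
have [p [cyc u sub fp lp]] := redirected_path (rs_uniq rs) pU dU gE.
apply/outerE; have /fpathE ep := fp; exists (size p).+1.
by rewrite /= -lp; congr (face s _); rewrite {2}ep last_traject.
Qed.

(** The outer face of the current map can enter [U] only at [d], and inside [U] its steps are those
    of [U] up to the exit to [c2]. *)
Let outer_U : {in md U, forall x, x \in outer -> x \in outer_face U}.
Proof.
have [sDU sIU] := rs_s rs; have [sD sI] := ps.
move=> x xU /outerE[n en]; rewrite -en in xU *; move: xU {x en}.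
have itD k : iter k (face s) d \in D0.
  by elim: k => [|k IH] /=; [apply: UD|apply: (proj1 pface)].
elim: n => [|n IH] /= tU; first by apply/(outerP _ sU); exists 0.
set z := iter n (face s) d in IH tU *.
have dO : d \in outer_face U by apply/(outerP _ sU); exists 0.
case: (boolP (z \in md U)) => zU.
  move: tU; rewrite /face att ?(rs_a rs) //; case: eqP => _ tU.
    by case: c2U => [|->//]; rewrite tU.
  have /(outerP _ sU)[m em] := IH zU; apply/(outerP _ sU); exists m.+1.
  by rewrite /= em /mphi aU.
have [w wU ew] := perm_on_surj (rs_uniq rs) (rs_s rs) tU.
suff -> : face s z = d by [].
move: ew; rewrite /face -/a => ew.
have azD : a z \in D0 by apply: (rs_a rs0); apply: itD.
have := att wU; case: eqP => [e _|_]; first by rewrite -ew e.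
rewrite ew => /(sI _ _ (UD wU) azD) H.
case/negP: zU; rewrite -(rs_inv rs0 (itD n : z \in D0)) -H.
by apply: (rs_a rs).
Qed.

Let J := behead (vroot U).

Let vU : [/\ vroot U = d :: J, fcycle (msg U) (d :: J), uniq (d :: J),
  {subset d :: J <= md U} & fpath s d J /\ s (last d J) = c2].
Proof.
have [q [cyc u sub fp lp]] := redirected_path (rs_uniq rs) (rs_s rs) dU att.
have eq : vroot U = d :: q.
  by apply: porb_cycle => //; apply: (uniq_leq_size u sub).
by rewrite /J eq.
Qed.

Let orbit_d : exists q, porb N0 s d = d :: J ++ q /\
  ((c2 = d /\ q = [::]) \/ (c2 \notin md U /\ exists q', q = c2 :: q')).
Proof.
have [_ _ u sub [fp lp]] := vU; have dD : d \in D0 by apply: UD.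
have szJ : size J < N0.
  by apply: (uniq_leq_size (_ : uniq (d :: J))) => // z /sub/UD.
case: c2U => [c2n|c2d]; last first.
  exists [::]; split; last by left.
  rewrite cats0; apply: porb_cycle => //=.
  by rewrite rcons_path fp /= lp c2d eqxx.
have [q [-> cyc uq subq]] := porbP uD0 ps dD (leqnn N0).
have fp2 : fpath s d (rcons J c2) by rewrite rcons_path fp /= lp eqxx.
have u2 : uniq (d :: rcons J c2).
  rewrite -rcons_cons rcons_uniq u andbT; apply: contraNN c2n; exact: sub.
have sub2 : {subset d :: rcons J c2 <= d :: q}.
  move=> z; rewrite inE => /predU1P[->|]; first exact: mem_head.
  move: fp2 => /fpathE -> /trajectP[i _ ->].
  by rewrite -iterSr; apply: fcycle_iter => //; rewrite mem_head.
have sz := uniq_leq_size u2 sub2; rewrite /= size_rcons !ltnS in sz.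
have fq : fpath s d q by move: cyc; rewrite /= rcons_path => /andP[].
exists (c2 :: drop (size J).+1 q); split; last by right; split=> //; eexists.
congr (_ :: _); rewrite -cat_rcons -[LHS](cat_take_drop (size J).+1); congr (_ ++ _).
have /fpathE -> := fp2; have /fpathE -> := fq.
by rewrite size_rcons take_traject.
Qed.

Let tl := behead (porb N0 s d).
Let i := find (fun x => x \in outer) tl.

(** No dart of [J] is outer, because [U] has one corner; so the search passes over [J]. *)
Let iE : nth d tl i = c2 /\ take i tl = J.
Proof.
have [_ _ u sub _] := vU; have [q [e H]] := orbit_d.
have nJ : ~~ has (fun x => x \in outer) J.
  apply/hasPn => x xJ; have xU : x \in md U by apply: sub; rewrite inE xJ orbT.
  apply/negP => /(outer_U xU) xo; have [ev _ _ _ _] := vU.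
  have := proj2 oU x; rewrite ev inE xJ orbT => /(_ isT xo) xd.
  by move: u; rewrite /= -[d](xd : x = d) xJ.
rewrite /i /tl e /=; case: H => [[-> ->]|[_ [q' ->]]].
  (* Here [c2 = d]: the search finds nothing, and the default value [d] of [nth] is the right
     answer. *)
  by rewrite cats0 hasNfind // take_size nth_default.
rewrite find_cat (negPf nJ) /= c2_outer addn0 nth_cat ltnn subnn take_size_cat //.
Qed.

Let Iv := d :: J.
Let V := comp (CMap D0 s a r0) Iv.

Let sE x : x \in md U -> s x = if x == last d J then c2 else msg U x.
Proof.
move=> xU; have [_ cyc _ sub _] := vU; rewrite att //.
move: cyc; rewrite /= rcons_path => /andP[_ /eqP l].
have lU : last d J \in md U by apply: sub; apply: mem_last.
case: (x =P last d J) => [->|nx]; first by rewrite l eqxx.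
by case: eqP => // e; case: nx; apply: (proj2 (rs_s rs)) => //; rewrite l.
Qed.

Let outV : outvU V = outvU U.
Proof.
have [_ cyc u sub _] := vU.
have cutE : {in md U, cut_sg s Iv =1 msg U}.
  move=> x xU; rewrite /cut_sg sE //=.
  move: cyc; rewrite /= rcons_path => /andP[_ /eqP l].
  case: (x =P last d J) => [->|nx]; first by rewrite mem_last l.
  by case: ifP.
have stepD : {in D0, forall x, {subset [:: a x; cut_sg s Iv x] <= D0}}.
  move=> x xD y; rewrite !inE => /orP[]/eqP->; first exact: (rs_a rs0).
  rewrite /cut_sg; case: ifP => _; last exact: (proj1 ps).
  by case: ifP => _ /=; [apply: UD|apply: (proj1 ps)].
have IvD : {subset Iv <= D0} by move=> z /sub/UD.
have [uC IC CD st' min] := closP u IvD isT stepD (leqnn N0).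
have CU : {in clos N0 (fun x => [:: a x; cut_sg s Iv x]) Iv, forall x, x \in md U}.
  apply: min => // x y _ xU; rewrite !inE => /orP[]/eqP->; first exact: (rs_a rs).
  by rewrite cutE //; apply: (proj1 (rs_s rs)).
have UC : {in md U, forall x, x \in clos N0 (fun x => [:: a x; cut_sg s Iv x]) Iv}.
  have [_ _ minU] := sU; apply: minU => [|z zU zC]; first by apply: IC; rewrite mem_head.
  by split; apply: (st' z zC); rewrite !inE ?aU ?eqxx // -cutE // eqxx orbT.
symmetry; apply: eq_outvU => //.
- by move=> x; apply/idP/idP; [apply: UC|apply: CU].
- by rewrite aU.
by move=> x xU; rewrite /V /= cutE.
Qed.

(** The step swaps the images of [d] and of the last dart of [J], both in [U]; hence its effect is
    confined to [U]. *)
Lemma wstep_new (st' := wstep M0 st) :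
  [/\ wf st', ws_vis st' = [:: d, a d & ws_vis st], ws_cur st' = ws_sg st' (a d),
      [/\ ws_sg st' d = c2, {in md U, forall x, x != d -> ws_sg st' x = detach U x}
        & forall x, x \notin md U -> ws_sg st' x = s x]
    & ws_lab st' (a d) = outvU U /\
      forall x, (x \notin md U) || (x == d) -> ws_lab st' x = ws_lab st x].
Proof.
have [_ cyc u sub [fp lp]] := vU.
have [ps' vD [n [en Hn]]] := wst; have [sD sI] := ps.
pose s' := if J is [::] then s else fun x => if x == d then c2 else
  if x == last d J then head d J else s x.
pose lab' x := if x \in porb N0 s' (a d) then outvU U else ws_lab st x.
have E : st' = WState s' [:: d, a d & ws_vis st] lab' (s' (a d)).
  rewrite /st' /wstep dcur (negPf (Uvis dU)) -/D0 -/a -/r0 -/N0 -/s -/outer -/tl -/i.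
  have [-> ->] := iE; rewrite -/Iv -/V outV /=.
  by rewrite /lab' /s'; case: (J).
(* For empty [J] the last dart is [d] and [c2 = s d], so one formula covers both cases. *)
have s'E x : s' x = if x == d then c2 else if x == last d J then s d else s x.
  rewrite /s'; case: (J) fp lp => [_ /= <-|j q /= /andP[/eqP<-]] //.
  by case: eqP => // ->.
have [l cd] : msg U (last d J) = d /\ forall x, x \in md U -> x != d ->
    s' x = detach U x.
  move: (cyc); rewrite /= rcons_path => /andP[_ /eqP l]; split=> // x xU nx.
  rewrite s'E (negPf nx) /detach -/d (negPf nx) !sE //.
  have lU : last d J \in md U by apply: sub; apply: mem_last.
  case: (x =P last d J) => [ex|nl].
    rewrite ex l eqxx; case: eqP => // dl.
    by rewrite ex -dl eqxx in nx.
  case: eqP => // e; case: nl; apply: (proj2 (rs_s rs)) => //; by rewrite l.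
have s'o x : x \notin md U -> s' x = s x.
  move=> xU; rewrite s'E; case: eqP => [xd|_]; first by rewrite xd dU in xU.
  case: eqP => // xl; case/negP: xU; rewrite xl; apply: sub; exact: mem_last.
have ps1 : perm_on D0 s'.
  apply: perm_on_eq (perm_on_swap ps (UD dU) (_ : last d J \in D0)); last exact/UD/sub/mem_last.
  by move=> x _ /=; rewrite s'E lp.
have adU : a d \in md U by apply: (rs_a rs).
have adn : a d != d by apply: (rs_nfix rs).
(* [detach U] fixes [d], so the vertex that receives the new label stays in [U] and avoids [d]. *)
have porb_sub x : x \in porb N0 s' (a d) -> (x \in md U) && (x != d).
  move=> /(mem_porb _ uD0 ps1 (UD adU) (leqnn N0))[k <-].
  elim: k => [|k /andP[kU kd]] /=; first by rewrite adU.
  have [[dtU dtI] _] := (rs_s (proj1 (detach_rotsys_connected oU)), 0).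
  rewrite cd // dtU //=; apply: contraNneq kd => e.
  by apply/eqP/dtI => //; rewrite e /detach eqxx.
rewrite E; split=> //=.
- split=> //=.
    move=> x; rewrite !inE => /or3P[/eqP->|/eqP->|/vD[xD ->]].
    + by rewrite eqxx orbT; split=> //; apply: UD.
    + have -> : mal M0 (a d) = d by apply: (rs_inv rs0); apply: UD.
      by rewrite eqxx; split=> //; apply: UD.
    by rewrite !orbT.
  (* Visited darts and their mates lie outside [U], where the rotation is unchanged, so the past of
     the walk is the same for [s']. *)
  have itE k : k <= n -> iter k (face s') r0 = iter k (face s) r0.
    elim: k => //= k IH lt; rewrite IH 1?ltnW // /face s'o //.
    apply/negP => kU; have /vD[kD kv] := Hn k lt.
    by have := Uvis kU; rewrite kv.
  exists n.+1; split=> /= [|k]; first by rewrite itE // en dcur.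
  rewrite ltnS => le; rewrite itE //; move: le; rewrite leq_eqVlt => /predU1P[->|/Hn kv].
    by rewrite en dcur mem_head.
  by rewrite !inE kv !orbT.
- by split=> //; rewrite s'E eqxx.
rewrite /lab'; split.
  by case: (mem_porb _ uD0 ps1 (UD adU) (leqnn N0)) => // -[]; exists 0.
by move=> x H; case: ifP => // /porb_sub/andP[xU xd]; rewrite xU (negPf xd) in H.
Qed.
End NewEdge.
End Walk.

Lemma tree_ofS N s a lab k x : tree_of N s a lab k.+1 x =
  Node (lab x) [seq tree_of N s a lab k (a y) | y <- rev (behead (porb N s x))].
Proof. by []. Qed.

(** * Traversal of whole components and maps *)

Section Traversal.
Variable M0 : cmap.
Let D0 := md M0.
Let a := mal M0.
Let N0 := size D0.
Hypothesis sM0 : sound M0.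
Let rs0 : rotsys D0 (msg M0) a. Proof. by case: sM0. Qed.

Definition unchanged (E : pred nat) (st st' : wstate) : Prop :=
  forall x, ~~ E x -> [/\ ws_sg st' x = ws_sg st x, ws_lab st' x = ws_lab st x
    & (x \in ws_vis st') = (x \in ws_vis st)].

Definition ready (E : seq nat) (st : wstate) : Prop :=
  {subset E <= md M0} /\ {in E, forall x, x \notin ws_vis st}.

Definition agree (E : pred nat) (st : wstate) (s lab : nat -> nat) : Prop :=
  forall x, E x -> s x = ws_sg st x /\ lab x = ws_lab st x.

Definition subtree (k k' : nat) (s lab : nat -> nat) (U : cmap) : Prop :=
  tree_of (size (md M0)) s (mal M0) lab k (mal M0 (mroot U)) =
  relabel (rho_f k' (Pi U)) (outvU U).

(** Later steps alter other darts, so the tree is read from any final [s] and [lab] that agree with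
    the state on [U]. The root dart is excepted, since it belongs to the parent vertex. The clause
    on intermediate positions rules out an early stop of [walk]. *)
Definition walks_component (U : cmap) : Prop := forall st e,
  wf M0 st -> ready (md U) st -> ws_cur st = mroot U -> attached (ws_sg st) U e ->
  e \notin md U \/ e = mroot U ->
  exists n (st' := iter n (wstep M0) st),
  [/\ 0 < n <= size (md U), ws_cur st' = e /\ wf M0 st',
      forall i, 0 < i < n -> ws_cur (iter i (wstep M0) st) \in rem (mroot U) (md U),
      unchanged (mem (md U)) st st' /\
        (ws_lab st' (mroot U) = ws_lab st (mroot U) /\ ws_sg st' (mroot U) = e)
    & forall s lab k k', size (md U) <= k -> size (md U) <= k' ->
      agree (fun x => (x \in md U) && (x != mroot U)) st' s lab -> subtree k k' s lab U].

(** [hs] lists clockwise the darts left at the root vertex after the walk, one per component; the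
    path through them to [e] yields the cycle from which children are read. *)
Definition walks_map (M : cmap) : Prop := forall st e,
  wf M0 st -> ready (md M) st -> ws_cur st = mroot M -> attached (ws_sg st) M e ->
  e \notin md M \/ e = mroot M ->
  exists n (st' := iter n (wstep M0) st) (hs := rev [seq mroot U | U <- comps M]),
  [/\ 0 < n <= size (md M), ws_cur st' = e /\ wf M0 st',
      forall i, 0 < i < n -> (ws_cur (iter i (wstep M0) st) \in md M) &&
        (ws_cur (iter i (wstep M0) st) != mroot M),
      unchanged (mem (md M)) st st' /\ ws_lab st' (mroot M) = ws_lab st (mroot M)
    & [/\ exists t, hs = mroot M :: t /\ fpath (ws_sg st') (mroot M) (rcons t e),
          uniq hs /\ {subset hs <= md M} &
        forall s lab k k', size (md M) <= k -> size (md M) <= k' ->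
          agree (mem (md M)) st' s lab ->
          [seq tree_of (size (md M0)) s (mal M0) lab k (mal M0 y) | y <- rev hs] =
          [seq relabel (rho_f k' (Pi U)) (outvU U) | U <- comps M]]].

(** One step along the root edge, [n] steps in [Pi U] with exit [p], one step back to [e]: [n + 2]
    in all, or two if [Pi U] has no dart. *)
Lemma walks_component_of_Pi U : one_corner U -> mal U = mal M0 ->
  (md (Pi U) != [::] -> walks_map (Pi U)) -> walks_component U.
Proof.
move=> oU aU wPi st e wst [UD Uvis] cur att eU.
set d := mroot U in cur att eU *.
have [sU _] := oU; have [rs dU _] := sU; rewrite -/d in dU.
set p := a d.
have pU : p \in md U by rewrite /p /a -aU; apply: (rs_a rs).
have pd : p != d by rewrite /p /a -aU; apply: (rs_nfix rs).
have ap : a p = d by apply: (rs_inv rs0); apply: UD.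
have [] := wstep_new sM0 wst oU aU UD cur Uvis att eU.
set st1 := wstep M0 st; rewrite -/d => wf1 vis1 cur1 [s1d s1U s1o] [labp lab1].
rewrite -/a -/p in vis1 cur1 labp.
have memPi x : (x \in md (Pi U)) = [&& x \in md U, x != d & x != p].
  by rewrite mem_filter !inE negb_or aU andbC.
have dPi : d \notin md (Pi U) by rewrite memPi eqxx andbF.
have pPi : p \notin md (Pi U) by rewrite memPi eqxx !andbF.
have PiU : {subset md (Pi U) <= md U} by move=> x; rewrite memPi => /andP[].
have szPi : (size (md (Pi U))).+2 <= size (md U).
  have u : uniq [:: d, p & md (Pi U)].
    by rewrite /= inE negb_or eq_sym pd dPi pPi filter_uniq // (rs_uniq rs).
  apply: (uniq_leq_size u) => x; rewrite !inE => /or3P[/eqP->|/eqP->|/PiU] //.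
have st1_un : unchanged (mem (md U)) st st1.
  move=> x /= xU; split; [exact: s1o|by apply: lab1; rewrite xU|].
  rewrite vis1 !inE; case: eqP => [xd|_]; first by rewrite xd dU in xU.
  by case: eqP => [xp|//]; rewrite xp pU in xU.
have memrem x : x \in md U -> x != d -> x \in rem d (md U).
  by move=> xU xd; rewrite mem_rem_uniq ?(rs_uniq rs) // !inE xd.
case: (boolP (md (Pi U) == [::])) => ePi.
  have dp : ws_sg st1 p = p.
    by rewrite s1U //; move: ePi; rewrite detach_leaf // aU => /eqP.
  rewrite dp in cur1.
  have [] := wstep_visited wf1; first by rewrite vis1 cur1 !inE eqxx orbT.
  rewrite cur1 -/a ap s1d => E wf2.
  exists 2; rewrite /= -/st1 E; split=> //.
  - by rewrite (leq_trans _ szPi).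
  - by move: wf2; rewrite E.
  - by case=> [|[|i]] //= _; rewrite -/st1 cur1 memrem.
  - by split=> //; split=> //; apply: lab1; rewrite eqxx orbT.
  move=> s lab k k' lk lk' ag.
  have [sp lp] : s p = p /\ lab p = outvU U by have [] := ag p; rewrite ?pU //= => -> ->.
  rewrite /subtree -/a -/d -/p.
  have -> : relabel (rho_f k' (Pi U)) (outvU U) = Node (outvU U) [::].
    by case: (k') => //= j; rewrite /comps ePi.
  case: k lk => [|k] lk; first by rewrite /= lp.
  by rewrite tree_ofS lp (@porb_cycle _ _ _ [::]) //= ?sp ?eqxx //; case: (md M0) (UD d dU).
have {}wPi := wPi ePi.
have [sPi mr attPi] := Pi_sound oU ePi.
rewrite aU -/a -/d -/p in mr attPi.
have cur1' : ws_cur st1 = mroot (Pi U) by rewrite cur1 mr s1U.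
have att1 : attached (ws_sg st1) (Pi U) p.
  move=> x xPi; have := memPi x; rewrite xPi => /esym/and3P[xU xd _].
  by rewrite s1U // attPi.
have ready1 : ready (md (Pi U)) st1.
  split=> [x /PiU/UD //|x xPi]; rewrite vis1 !inE (negPf (Uvis x (PiU x xPi))).
  by have := memPi x; rewrite xPi orbF negb_or => /esym/and3P[_ -> ->].
have [n [/andP[n0 nle] [cur2 wf2] mid [un2 lab2] [[t [hsE ft]] [uhs hsPi] tree]]] :=
  wPi st1 p wf1 ready1 cur1' att1 (or_introl pPi).
set st2 := iter n (wstep M0) st1 in cur2 wf2 un2 lab2 ft tree.
have [s2d l2d v2d] := un2 d dPi; have [s2p l2p v2p] := un2 p pPi.
have [] := wstep_visited wf2; first by rewrite cur2 v2p vis1 !inE eqxx orbT.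
rewrite cur2 -/a ap s2d s1d => E wf3.
exists n.+2; rewrite iterS iterSr -/st1 -/st2 E; split=> //=.
- exact: leq_trans szPi.
- by move: wf3; rewrite E.
- case=> [|[|i]] // /andP[_ lt]; first (have [_ rPi _] := sPi).
    have := memPi (mroot (Pi U)); rewrite rPi => /esym/and3P[rU rd _].
    by rewrite /= -/st1 cur1' memrem.
  rewrite iterSr -/st1; move: lt; rewrite !ltnS leq_eqVlt => /predU1P[e1|lt].
    by rewrite e1 -/st2 cur2 memrem.
  have /andP[/[dup]/PiU cU + _] := mid i.+1 lt; rewrite memPi => /and3P[_ cd _].
  exact: memrem.
- split; last by rewrite l2d lab1 ?eqxx ?orbT // s2d.
  move=> x xU /=; have xPi : x \notin md (Pi U) by apply: contraNN xU; apply: PiU.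
  by have [-> -> ->] := un2 x xPi; apply: st1_un.
move=> s lab k k' lk lk' ag.
have agp : s p = ws_sg st2 p /\ lab p = ws_lab st2 p by apply: ag; rewrite pU.
have [sp lp] : s p = mroot (Pi U) /\ lab p = outvU U.
  by have [-> ->] := agp; rewrite s2p l2p labp -cur1' cur1.
have lk0 := leq_trans szPi lk; have lk0' := leq_trans szPi lk'.
case: k lk0 {lk} => // k lk; case: k' lk0' {lk'} => // k' lk'.
have agPi : agree (mem (md (Pi U))) st2 s lab.
  move=> x xPi; apply: ag; have := memPi x; rewrite [x \in md (Pi U)]xPi.
  by move=> /esym/and3P[-> ->].
rewrite /subtree -/a -/d -/p.
have hD : {subset rev [seq mroot V | V <- comps (Pi U)] <= md M0} by move=> x /hsPi/PiU/UD.
(* The final vertex of [p] consists of [p] and the roots of the components of [Pi U], so these are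
   the children that [tree_of] reads. *)
have cyc : fcycle s (p :: mroot (Pi U) :: t).
  rewrite /= sp eqxx /= -(@eq_in_fpath (ws_sg st2)) // => x; rewrite belast_rcons => xt.
  have [] // := agPi x; apply: hsPi; rewrite hsE; exact: xt.
have u : uniq (p :: mroot (Pi U) :: t).
  rewrite -hsE cons_uniq uhs andbT; apply: contraNN pPi; exact: hsPi.
have szt : size (mroot (Pi U) :: t) < size (md M0).
  apply: (uniq_leq_size u) => x; rewrite inE => /predU1P[->|]; first exact: UD.
  rewrite -hsE; exact: hD.
have {}tree := tree s lab k k' _ _ agPi.
rewrite tree_ofS lp (porb_cycle cyc u szt) [behead _]/= -hsE -/a tree //.
- exact: ltnW.
- exact: ltnW.
Qed.

(** * Consecutive components at one vertex *)

Section Runs.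
Variable M : cmap.
Hypothesis aM : mal M = mal M0.
Let U_ R := comp M R.
Let hd R : nat := head 0 R.
Let nxt (Rs : seq (seq nat)) e : nat := head e (map hd Rs).

Fixpoint linked (s : nat -> nat) (Rs : seq (seq nat)) (e : nat) : Prop :=
  if Rs is R :: Rs' then
    [/\ attached s (comp M R) (head e [seq head 0 R | R <- Rs']),
        head e [seq head 0 R | R <- Rs'] \notin md (comp M R) \/
          head e [seq head 0 R | R <- Rs'] = head 0 R
      & linked s Rs' e]
  else True.

Let inU (Rs : seq (seq nat)) (x : nat) := has (fun R => x \in md (U_ R)) Rs.

Lemma eq_linked s s' Rs e : (forall x, inU Rs x -> s' x = s x) ->
  linked s Rs e -> linked s' Rs e.
Proof.
elim: Rs => //= R Rs IH E [att no lk]; split=> //.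
  by move=> x xU; rewrite E ?xU //; apply: att.
by apply: IH lk => x xU; rewrite E // xU orbT.
Qed.

Lemma walks_runs Rs st e :
  {in Rs, forall R, walks_component (U_ R) /\ sound (U_ R)} ->
  pairwise (fun R R' => all (fun z => z \notin md (U_ R)) (md (U_ R'))) Rs ->
  wf M0 st -> {in Rs, forall R, ready (md (U_ R)) st} ->
  ws_cur st = nxt Rs e -> linked (ws_sg st) Rs e ->
  exists n (st' := iter n (wstep M0) st),
  [/\ size Rs <= n <= sumn [seq size (md (U_ R)) | R <- Rs], ws_cur st' = e /\ wf M0 st',
      forall i, 0 < i < n -> inU Rs (ws_cur (iter i (wstep M0) st)) &&
        (ws_cur (iter i (wstep M0) st) != nxt Rs e),
      unchanged (inU Rs) st st' /\ {in Rs, forall R, ws_lab st' (hd R) = ws_lab st (hd R)}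
    & (if map hd Rs is h :: t then fpath (ws_sg st') h (rcons t e) else true) /\
      forall s lab k k',
        {in Rs, forall R, size (md (U_ R)) <= k /\ size (md (U_ R)) <= k'} ->
        agree (inU Rs) st' s lab -> {in Rs, forall R, subtree k k' s lab (U_ R)}].
Proof.
elim: Rs st => [|R Rs IH] st walks /= dis wst rdy cur lk.
  by exists 0; split=> // i; case: i.
have [wR sR] := walks R (mem_head _ _); have [rsR hR _] := sR; have [att no lk'] := lk.
have /andP[dR dis'] := dis.
have inR : forall S, S \in Rs -> S \in R :: Rs by move=> S SR; rewrite inE SR orbT.
have [n1 [/andP[n10 n1le] [cur1 wf1] mid1 [un1 [lab1 sg1]] tree1]] :=
  wR st _ wst (rdy R (mem_head _ _)) cur att no.
set st1 := iter n1 (wstep M0) st in cur1 wf1 un1 lab1 sg1 tree1.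
have sep x : inU Rs x -> x \notin md (U_ R).
  by move=> /hasP[S SR xS]; have /allP/(_ S SR)/allP/(_ x xS) := dR.
have rdy1 : {in Rs, forall S, ready (md (U_ S)) st1}.
  move=> S SR; have [sub nv] := rdy S (inR S SR); split=> // x xS.
  have [_ _ ->] := un1 x (sep x (introT hasP (ex_intro2 _ _ S SR xS))); exact: nv.
have lk1 : linked (ws_sg st1) Rs e.
  by apply: eq_linked lk' => x /sep/un1[].
have walks' : {in Rs, forall S, walks_component (U_ S) /\ sound (U_ S)}.
  by move=> S SR; apply: walks; apply: inR.
have [n2 [/andP[n2ge n2le] [cur2 wf2] mid2 [un2 lab2] [path2 tree2]]] :=
  IH st1 walks' dis' wf1 rdy1 cur1 lk1.
set st2 := iter n2 (wstep M0) st1 in cur2 wf2 un2 lab2 path2 tree2.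
have outR x : x \in md (U_ R) -> ~~ inU Rs x by move=> xR; apply/negP => /sep; rewrite xR.
have st2E : iter (n1 + n2) (wstep M0) st = st2 by rewrite addnC iterD.
exists (n1 + n2); rewrite /= st2E; split=> //.
- rewrite leq_add // andbT; apply: leq_trans (leq_add n10 n2ge); exact: leqnn.
- move=> i /andP[i0 ilt]; case: (ltngtP i n1) => [lt|gt|ei].
  + have := mid1 i; rewrite i0 lt => /(_ isT) c.
    by move: c; rewrite mem_rem_uniq ?(rs_uniq rsR) // !inE => /andP[cd ->].
  + have ei : iter i (wstep M0) st = iter (i - n1) (wstep M0) st1.
      by rewrite -iterD subnK // ltnW.
    have lt2 : i - n1 < n2 by rewrite ltn_subLR // ltnW.
    have := mid2 (i - n1); rewrite -ei subn_gt0 gt lt2 => /(_ isT)/andP[c _]; rewrite c orbT /=.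
    by apply: contraNneq (sep _ c) => ->.
  (* At time [n1] the walk stands at the root of the next run; if there is none, [n2 = 0] and [i] is
     out of range. *)
  rewrite ei -/st1 cur1; case eRs: Rs n2le => [|S Rs'] /= n2le.
    by move: ilt; rewrite ei ltnNge => /negP[]; rewrite -[X in _ <= X]addn0 leq_add2l.
  have cS : inU Rs (hd S).
    by apply/hasP; exists S; rewrite ?eRs ?mem_head //; have [_ []] := walks' S ltac:(by rewrite eRs mem_head).
  apply/andP; split; last by apply: contraNneq (sep _ cS) => e'; rewrite /hd e'; exact: hR.
  by apply/orP; right; move: cS; rewrite /inU eRs.
- split=> [x /norP[xR xRs]|S].
    by have [-> -> ->] := un2 x xRs; apply: un1.
  rewrite inE => /predU1P[->|SR].
    by have [_ -> _] := un2 (hd R) (outR _ hR).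
  have hS : hd S \notin md (U_ R); last by rewrite lab2 //; have [_ ->] := un1 _ hS.
  by apply: sep; apply/hasP; exists S => //; have [_ []] := walks' S SR.
split.
  have [sgR _ _] := un2 (hd R) (outR _ hR).
  case eRs: Rs path2 => [|S Rs'] /=; rewrite sgR sg1 eRs /= ?eqxx //.
move=> s lab k k' le ag S; rewrite inE => /predU1P[->|SR].
  have [lek lek'] := le R (mem_head _ _).
  apply: tree1 => // x /andP[xR xd]; have [|-> ->] := ag x; first by rewrite /= xR.
  by have [-> -> _] := un2 x (outR x xR).
apply: (tree2 s lab) => // [T TR|x xRs]; first exact/le/inR.
by apply: ag; rewrite /= xRs orbT.
Qed.

Lemma fpath_belast (f : nat -> nat) x p z : fpath f x p -> z \in belast x p -> f z \in p.
Proof.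
elim: p x => //= y p IH x /andP[/eqP <- fp]; rewrite inE => /predU1P[->|zp].
  exact: mem_head.
by rewrite inE (IH _ fp zp) orbT.
Qed.

Lemma msg_vroot x : sound M -> x \in md M -> msg M x \in vroot M -> x \in vroot M.
Proof.
move=> sM xD; have [p [ev cyc _ _]] := vrootP sM; have [rs _ _] := sM.
have [m em] := perm_on_iter_sym (rs_uniq rs) (rs_s rs) xD (erefl (iter 1 (msg M) x)).
by rewrite ev => sx; rewrite -em; apply: fcycle_iter.
Qed.

(** The path condition sends the last dart of each run to the head of the next one, or to [e]; what
    remains is that other darts of a component still follow its own rotation. *)
Lemma linked_runs s Rs e : sound M -> {in Rs, forall R, run_spec M R} ->
  uniq (flatten Rs) -> {subset flatten Rs <= vroot M} ->
  {in Rs, forall R, mroot M \in R -> mroot M = hd R} ->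
  attached s M e -> e \notin md M \/ e = mroot M ->
  (if flatten Rs is h :: t then fpath s h (rcons t e) else true) -> linked s Rs e.
Proof.
move=> sM + + + + att eM; elim: Rs => //= R Rs IH spec.
have [rs rD _] := sM; have [pv [ev _ _ subv]] := vrootP sM.
have [[b [R' eR]] oR vR sub meet] := spec R (mem_head _ _).
have spec' : {in Rs, forall R, run_spec M R}.
  by move=> S SR; apply: spec; rewrite inE SR orbT.
have nxtE : nxt Rs e = head e (flatten Rs).
  by case: (Rs) spec' => //= S L /(_ S (mem_head _ _))[[c [S' ->]]].
rewrite cat_uniq => /and3P[uR dis uF] subF rH path.
have : fpath s b (rcons (R' ++ flatten Rs) e) by move: path; rewrite eR.
rewrite rcons_cat cat_path => /andP[fp lp].
have lpE : s (last b R') = nxt Rs e.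
  by rewrite nxtE; move: lp; case: (flatten Rs) => [|c F] /= /andP[/eqP->].
have [[rsU _ _] _] := oR.
have RU : {subset R <= md (comp M R)}.
  have [q [ev' _ _ subq]] := vrootP (proj1 oR).
  by move=> z zR; apply: subq; rewrite -ev' vR.
have Rv : {subset R <= vroot M} by move=> z zR; apply: subF; rewrite mem_cat zR.
have msgl : msg (comp M R) (last b R') = b.
  by rewrite /= /cut_sg eR /= mem_last eqxx.
split; last first.
- apply: IH => //.
  + by move=> z zF; apply: subF; rewrite mem_cat zF orbT.
  + by move=> S SR; apply: rH; rewrite inE SR orbT.
  by move: lp; case: (flatten Rs) => [|c F] //= /andP[].
- rewrite -/(nxt Rs e) nxtE; case eF: (flatten Rs) => [|c F] /=.
    case: eM => [eM|->]; first by left; apply: contraNN eM; apply: sub.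
    case: (boolP (mroot M \in md (comp M R))) => rU; [right|by left].
    by apply: rH (meet _ rU _); rewrite ?mem_head // ev mem_head.
  have cF : c \in flatten Rs by rewrite eF mem_head.
  left; apply/negP => cU; move/hasP: dis; apply; exists c => //.
  by apply: meet => //; apply: subF; rewrite mem_cat cF orbT.
move=> x xU; rewrite -/(nxt Rs e) [mroot _]/= [head 0 R](_ : _ = b) ?eR //.
rewrite -eR; have xM := sub x xU.
case: (x =P last b R') => [->|nl]; first by rewrite lpE msgl eqxx.
have lR : last b R' \in R by rewrite eR mem_last.
case: eqP => [ex|nb].
  by case: nl; apply: (proj2 (rs_s rsU)) => //; [exact: RU|rewrite msgl].
have -> : msg (comp M R) x = msg M x.
  by rewrite /= /cut_sg eR; case: ifP => // _ /=; case: eqP.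
rewrite att //; case: eqP => // er.
case: (boolP (x \in R)) => xR; last first.
  have xv : x \notin vroot M by apply: contraNN xR; apply: meet.
  by case/negP: xv; apply: msg_vroot => //; rewrite er ev mem_head.
have xb : x \in belast b R'.
  by move: xR; rewrite eR lastI mem_rcons inE => /predU1P[/nl|].
(* A dart before the last of its run can be sent to [e] only if [e] is in the run; then
   [e = mroot M] and the redirection is void. *)
have := fpath_belast fp xb; rewrite att // er eqxx => eR'.
case: eM => [/negP[]|->]; last by [].
by apply/sub/RU; rewrite eR inE eR' orbT.
Qed.

Lemma sumn_disjoint Rs (D : seq nat) : uniq D ->
  {in Rs, forall R, uniq (md (U_ R)) /\ {subset md (U_ R) <= D}} ->
  pairwise (fun R R' => all (fun z => z \notin md (U_ R)) (md (U_ R'))) Rs ->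
  sumn [seq size (md (U_ R)) | R <- Rs] <= size D.
Proof.
move=> uD H dis; suff u : uniq (flatten [seq md (U_ R) | R <- Rs]).
  have -> : [seq size (md (U_ R)) | R <- Rs] = shape [seq md (U_ R) | R <- Rs].
    by rewrite /shape -map_comp.
  rewrite -size_flatten; apply: uniq_leq_size => // x /flatten_mapP[R RR].
  exact: (proj2 (H R RR)).
elim: Rs H dis => //= R Rs IH H /andP[/allP dR dis]; rewrite cat_uniq IH //; last first.
  by move=> S SR; apply: H; rewrite inE SR orbT.
rewrite (proj1 (H R (mem_head _ _))) andbT /=; apply/hasPn => x /flatten_mapP[S SR xS].
by have /allP/(_ x xS) := dR S SR.
Qed.

Lemma uniq_heads (Rs : seq (seq nat)) : {in Rs, forall R, hd R \in R} ->
  uniq (flatten Rs) -> uniq (map hd Rs).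
Proof.
elim: Rs => //= R Rs IH H; rewrite cat_uniq => /and3P[_ dis uF].
rewrite IH // ?andbT; last by move=> S SR; apply: H; rewrite inE SR orbT.
apply: contraNN dis => /mapP[S SR e]; apply/hasP; exists (hd R); last exact/H/mem_head.
by apply/flattenP; exists S; rewrite // e; apply: H; rewrite inE SR orbT.
Qed.

Lemma walks_map_of_components : sound M ->
  (forall R, run_spec M R -> walks_component (U_ R)) -> walks_map M.
Proof.
move=> sM wC st e wst [MD Mvis] cur att eM.
have [Rs [cE fE spec dis]] := compsP sM.
have [p [ev cyc u sub]] := vrootP sM; have [rs rD _] := sM.
have hR : {in Rs, forall R, hd R \in R}.
  by move=> R /spec[[b [R' ->]]] *; exact: mem_head.
have uF : uniq (flatten Rs) by rewrite fE ev.
have hsE : rev [seq mroot U | U <- comps M] = map hd Rs.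
  by rewrite cE map_rev revK -map_comp.
have [t ht] : exists t, map hd Rs = mroot M :: t.
  move: fE; rewrite ev; case eRs: Rs => [|R L] //=.
  have RR : R \in Rs by rewrite eRs mem_head.
  have [[b [R' ->]] _ _ _ _] := spec R RR.
  by move=> [-> _]; eexists.
have rH : {in Rs, forall R, mroot M \in R -> mroot M = hd R}.
  move: ht uF; case: (Rs) hR => //= R L hR [hr _]; rewrite cat_uniq => /and3P[_ dR _] S.
  rewrite inE => /predU1P[-> //|SL rS]; case/negP: dR; apply/hasP; exists (mroot M).
    by apply/flattenP; exists S.
  by rewrite -hr; apply: hR; rewrite mem_head.
have lk : linked (ws_sg st) Rs e.
  apply: linked_runs => //; first by move=> x; rewrite fE.
  rewrite fE; have [q [cq uq sq fq lq]] := redirected_path (rs_uniq rs) (rs_s rs) rD att.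
  have -> : vroot M = mroot M :: q by apply: porb_cycle => //; apply: (uniq_leq_size uq sq).
  by rewrite rcons_path fq /= lq eqxx.
have walks : {in Rs, forall R, walks_component (U_ R) /\ sound (U_ R)}.
  by move=> R /spec sR; split; [apply: wC|case: sR => _ []].
have rdy : {in Rs, forall R, ready (md (U_ R)) st}.
  by move=> R /spec[_ _ _ sR _]; split=> x /sR; [apply: MD|apply: Mvis].
have curE : ws_cur st = nxt Rs e by rewrite /nxt ht.
have [n [/andP[n0 nle] [cur2 wf2] mid [un lab] [path tree]]] :=
  walks_runs walks dis wst rdy curE lk.
have inM x : inU Rs x -> x \in md M by move=> /hasP[R /spec[_ _ _ sR _]]; apply: sR.
have szR : {in Rs, forall R, size (md (U_ R)) <= size (md M)}.
  move=> R RR; have [_ [[rU _ _] _] _ sR _] := spec R RR.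
  exact: uniq_leq_size (rs_uniq rU) sR.
exists n; rewrite hsE; split=> //.
- rewrite (leq_trans _ n0); last by case: (Rs) ht.
  apply: leq_trans nle _; apply: sumn_disjoint => //; first exact: rs_uniq rs.
  by move=> R /spec[_ [[rU _ _] _] _ sR _]; split=> //; apply: rs_uniq rU.
- by move=> i /mid; rewrite /nxt ht /= => /andP[/inM ->].
- split; first by move=> x xM; apply: un; apply: contraNN xM; apply: inM.
  move: ht lab; case: (Rs) => //= R L [<- _] lab; apply: lab; exact: mem_head.
split.
- by exists t; split=> //; move: path; rewrite ht.
- split; first exact: uniq_heads.
  move=> x /mapP[R RR ->]; apply: sub; rewrite -ev -fE; apply/flattenP; exists R => //.
  exact: hR.
move=> s lab' k k' lk1 lk1' ag; rewrite cE -!map_rev -!map_comp; apply/eq_in_map => R.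
rewrite mem_rev => RR; apply: tree (RR) => [S SR|x /inM xM]; last exact: ag.
by split; [apply: leq_trans lk1|apply: leq_trans lk1']; apply: szR.
Qed.
End Runs.

Lemma walks_map_all M : sound M -> mal M = mal M0 -> walks_map M.
Proof.
have [m] := ubnP (size (md M)); elim: m M => // m IH M szM sM aM.
apply: walks_map_of_components => // R [_ oR _ sub _].
apply: walks_component_of_Pi => // nPi.
have [sPi _ _] := Pi_sound oR nPi; apply: IH => //.
have [[rU dU _] _] := oR; have [rs _ _] := sM.
rewrite ltnS in szM; apply: leq_trans szM.
have u : uniq (mroot (comp M R) :: md (Pi (comp M R))).
  by rewrite /= mem_filter inE eqxx /= filter_uniq // (rs_uniq rU).
apply: leq_trans (uniq_leq_size (rs_uniq rU) sub); apply: (uniq_leq_size u) => x.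
by rewrite inE mem_filter => /predU1P[->|/andP[]].
Qed.

Lemma walk_iter n k st : 0 < n <= k -> ws_cur (iter n (wstep M0) st) = mroot M0 ->
  (forall i, 0 < i < n -> ws_cur (iter i (wstep M0) st) != mroot M0) ->
  walk M0 k st = iter n (wstep M0) st.
Proof.
elim: k n st => [|k IH] [|n] st //= lt cur mid.
case: (posnP n) => [n0|n0]; first by rewrite n0 /= in cur *; rewrite cur eqxx.
have /= /negPf-> := mid 1 n0.
rewrite -iterS iterSr; apply: IH; first by rewrite n0 -ltnS.
  by rewrite -iterSr.
by move=> i /andP[i0 lti]; rewrite -iterSr; apply: mid; exact: lti.
Qed.

(** [M0] is attached to itself with exit [mroot M0], so its traversal ends exactly where [walk]
    stops. *)
Theorem rho_rho' : rho M0 = rho' M0.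
Proof.
have [rs rD _] := sM0.
pose init := WState (msg M0) [::]
  (fun x => if x \in porb (size (md M0)) (msg M0) (mroot M0) then outv M0 else 0) (mroot M0).
have winit : wf M0 init.
  by split=> //; [exact: rs_s rs|exists 0].
have [||n [/andP[n0 nle] [cur _] mid [_ lab] [[t [hsE ft]] [uhs hsD] tree]]] :=
  walks_map_all sM0 erefl winit _ erefl _ (or_intror erefl).
- by split.
- by move=> x xD /=; case: eqP.
rewrite /rho' (negPf (_ : md M0 != [::])); last by case: (md M0) rD.
rewrite -/init (@walk_iter n) //; first last.
- by move=> i /mid/andP[].
(* The fuel suffices: the walk takes at most [size (md M0)] steps. *)
- by rewrite n0 (leq_trans nle) // mulSn -addnA leq_addr.
set st := iter n _ _ in cur lab ft tree *.
have hs_porb : porb (size (md M0)) (ws_sg st) (mroot M0) = rev [seq mroot U | U <- comps M0].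
  rewrite hsE in uhs hsD *; apply: porb_cycle => //; exact: (uniq_leq_size uhs hsD).
have rv : mroot M0 \in porb (size (md M0)) (msg M0) (mroot M0).
  by apply/(mem_porb _ (rs_uniq rs) (rs_s rs) rD (leqnn _)); exists 0.
rewrite hs_porb lab /= rv /rho; congr (Node _ _); symmetry.
exact: tree.
Qed.
End Traversal.

(** * Euler's relation *)

Section Euler.
Variable D : seq nat.
Hypothesis uD : uniq D.
Let T := seq_sub D.

Lemma perm_on_seq_sub f : perm_on D f -> exists u : {perm T}, forall i, val (u i) = f (val i).
Proof.
move=> [fD fI].
have vf (i : T) : val (insubd i (f (val i))) = f (val i).
  by rewrite val_insubd fD //; apply: valP.
have inj : injective (fun i : T => insubd i (f (val i))).
  by move=> i j /(congr1 val); rewrite !vf => /fI e; apply/val_inj/e; apply: valP.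
by exists (perm inj) => i; rewrite permE vf.
Qed.

Lemma iter_perm_val (u : {perm T}) f i n : (forall i, val (u i) = f (val i)) ->
  val ((u ^+ n)%g i) = iter n f (val i).
Proof. by move=> E; rewrite permX; elim: n => //= n <-; rewrite E. Qed.

Lemma leq_card_porbits (g : nat -> nat) (w : {perm T}) :
  (forall i j, j \in porbit w i -> g (val j) = g (val i)) ->
  size (undup (map g D)) <= #|porbits w|.
Proof.
move=> inv; pose rep (A : {set T}) := if [pick i in A] is Some i then g (val i) else 0.
rewrite -(size_image rep) uniq_leq_size ?undup_uniq // => x.
rewrite mem_undup => /mapP[y yD ->]; apply/imageP.
exists (porbit w (SeqSub yD)); first exact: imset_f.
rewrite /rep; case: pickP => [j /inv-> //|/(_ (SeqSub yD))].
by rewrite porbit_id.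
Qed.

(** As [genus0] is an inequality, lower bounds on the three cycle counts suffice. *)
Lemma genus0_euler s a (u v : {perm T}) :
  perm_on D s -> perm_on D a -> {in D, forall x, a (a x) = x} ->
  (forall i, val (u i) = s (val i)) -> (forall i, val (v i) = a (val i)) ->
  ncc u v <= 1 ->
  (size D) %/ 2 + 2 <= size (undup [seq orep (size D) s x | x <- D]) +
    size (undup [seq orep (size D) (fun x => s (a x)) x | x <- D]) ->
  genus0 u v.
Proof.
move=> ps pa aI uE vE c1 euler; rewrite /genus0.
have cT : #|{: T}| = size D by rewrite card_seq_sub.
have pphi : perm_on D (fun x => s (a x)).
  have [sD sI] := ps; have [aD aJ] := pa; split=> [x xD|x y xD yD /sI/aJ]; first exact/sD/aD.
  by move=> H; apply: H; rewrite ?aD.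
have nV : size (undup [seq orep (size D) s x | x <- D]) <= #|porbits u|.
  apply: leq_card_porbits => i j /porbitP[k ->]; symmetry.
  by apply/(orepP uD ps (valP _) (valP _) (leqnn _)); exists k; rewrite (iter_perm_val _ _ uE).
(* [u * v] acts as [a (s x)], the faces as [s (a x)]; shifting the argument by [s] passes from one
   to the other. *)
have nF : size (undup [seq orep (size D) (fun x => s (a x)) x | x <- D]) <= #|porbits (u * v)%g|.
  apply: (@leq_trans (size (undup [seq orep (size D) (fun x => s (a x)) (s x) | x <- D]))).
    apply: uniq_leq_size; rewrite ?undup_uniq // => y; rewrite !mem_undup => /mapP[x xD ->].
    have [z zD <-] := perm_on_surj uD ps xD; exact: (map_f (fun x => orep _ _ (s x))).
  apply: (leq_card_porbits (g := fun x => orep (size D) (fun x => s (a x)) (s x))).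
  move=> i j /porbitP[k ->]; symmetry.
  have [sD _] := ps; apply/(orepP uD pphi (sD _ (valP _)) (sD _ (valP _)) (leqnn _)).
  exists k; rewrite (iter_perm_val (f := fun x => a (s x))); last first.
    by move=> l; rewrite permM vE uE.
  by elim: k => //= k ->.
(* Each edge is represented by its smaller dart, and [D] is covered by these darts and their
   mates. *)
have nE : size D <= #|porbits v|.*2.
  set L := undup (map (fun x => minn x (a x)) D).
  have : size L <= #|porbits v|.
    apply: leq_card_porbits => i j /porbitP[k ->]; rewrite (iter_perm_val _ _ vE).
    have iD := valP i; elim: k => //= k <-.
    have : iter k a (val i) \in D by elim: k => //= k; apply: (proj1 pa).
    by move=> kD; rewrite aI // minnC.
  rewrite -leq_double; apply: leq_trans.
  rewrite -addnn -{2}(size_map a L) -size_cat; apply: uniq_leq_size => // x xD.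
  have : minn x (a x) \in L by rewrite mem_undup; apply: (map_f (fun x => minn x (a x))).
  rewrite mem_cat /minn; case: ifP => _ xL; first by rewrite xL.
  by apply/orP; right; rewrite -(aI x xD) map_f.
have := leq_add (leq_add nV nE) nF; move: euler c1 nV nE nF; rewrite cT.
move: (size D) (size (undup _)) (size (undup _)) #|porbits u| #|porbits v| #|porbits (u * v)%g|.
move=> n x y p q r; lia.
Qed.
End Euler.

Lemma sound_of_planar M : rooted_planar_map M -> md M != [::] -> sound M.
Proof.
move=> [[uD ps pa] [inv [root [conn euler]]]] ne.
have {}root := root ne; have {}euler := euler ne.
have stepD : {in md M, forall x, {subset [:: msg M x; mal M x] <= md M}}.
  by move=> x xD y; rewrite !inE => /orP[]/eqP->; [apply: (proj1 ps)|apply: (proj1 pa)].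
have rD : {subset [:: mroot M] <= md M} by move=> x; rewrite inE => /eqP->.
have [_ _ _ _ min] := closP (isT : uniq [:: mroot M]) rD isT stepD (leqnn _).
have reach (A : pred nat) : A (mroot M) ->
    {in md M, forall z, A z -> A (msg M z) /\ A (mal M z)} -> {in md M, forall z, A z}.
  move=> Ar cA z zD; suff /andP[] : A z && (z \in md M) by [].
  apply: (min (fun z => A z && (z \in md M)) _ _ z (conn z zD)).
    by move=> x; rewrite inE => /eqP->; rewrite Ar.
  move=> x y _ /andP[Ax xD]; have [A1 A2] := cA x xD Ax.
  by rewrite !inE => /orP[]/eqP->; rewrite ?A1 ?A2 ?(proj1 ps) ?(proj1 pa).
split=> //.
have [u uE] := perm_on_seq_sub ps; have [v vE] := perm_on_seq_sub pa.
split=> //; [exact: (proj1 pa)|by move=> x /inv[]|by move=> x /inv[]|].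
exists (seq_sub (md M)), val, u, v; split=> //; first exact: val_inj.
  by move=> x xD; exists (SeqSub xD).
apply: (genus0_euler uD ps pa _ uE vE) => [x /inv[] //||]; last by rewrite -euler.
(* Every dart is reached from the root, so all classes equal that of the root and [ncc u v <= 1]. *)
pose i0 : seq_sub (md M) := SeqSub root.
have all_i0 i : gclass u v i = gclass u v i0.
  apply: gclass_eq.
  have : [exists j in gclass u v i0, val j == val i].
    apply: (reach (fun x => [exists j in gclass u v i0, val j == x])); last exact: valP.
      by apply/exists_inP; exists i0; rewrite ?gclass_refl.
    move=> z zD /exists_inP[j jG /eqP <-]; split; apply/exists_inP.
      by exists (u j); rewrite ?gclassL // uE.
    by exists (v j); rewrite ?gclassR // vE.
  by move=> /exists_inP[j jG /eqP/val_inj <-].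
rewrite /ncc -(cards1 (gclass u v i0)); apply: subset_leq_card.
by apply/subsetP => _ /imsetP[i _ ->]; rewrite inE all_i0.
Qed.

Theorem theorem5 (n : nat) (M : cmap) :
  rooted_planar_map M -> size (md M) = (2 * n)%N -> rho M = rho' M.
Proof.
move=> pM _; have [e|ne] := eqVneq (md M) [::].
  by rewrite /rho /rho' /= /comps e.
exact/rho_rho'/sound_of_planar.
Qed.
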